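(* For all $n\ge 0$, there are isomorphisms of real algebras $$\mathrm{Cl}_{0,n+8}\cong \mathrm{Cl}_{0,n}\otimes \mathrm{Cl}_{0,8},\qquad \mathrm{Cl}_{n+8,0}\cong \mathrm{Cl}_{n,0}\otimes \mathrm{Cl}_{8,0}.$$ Furthermore, $\mathrm{Cl}_{0,8}\cong \mathrm{Cl}_{8,0}\cong \mathbb{R}(16)$.
   Context: $\mathrm{Cl}_{p,q}$ denotes the real Clifford algebra of $\mathbb{R}^{p+q}$ with the quadratic form $\Phi_{p,q}(x)=x_1^2+\cdots+x_p^2-(x_{p+1}^2+\cdots+x_{p+q}^2)$, with sign convention $v^2=\Phi_{p,q}(v)\cdot 1$; that is, $\mathrm{Cl}_{p,q}=T(\mathbb{R}^{p+q})/\mathfrak{A}$, where $T(\mathbb{R}^{p+q})$ is the tensor algebra and $\mathfrak{A}$ is the two-sided ideal generated by all $v\otimes v-\Phi_{p,q}(v)\cdot 1$. $\otimes$ is the ordinary (ungraded) tensor product of algebras over $\mathbb{R}$, with multiplication $(a\otimes a')(b\otimes b')=(ab)\otimes(a'b')$. $\mathbb{R}(m)$ is the algebra of $m\times m$ real matrices. *)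

(* Defs.v *)
From HB Require Import structures.
From mathcomp Require Import all_boot all_order all_algebra.
From mathcomp Require Import generic_quotient ring_quotient finmap.
From mathcomp Require Import boolp reals.
From mathcomp.multinomials Require Import monalg.

Set Implicit Arguments.
Unset Strict Implicit.
Unset Printing Implicit Defensive.

Import GRing.Theory.
Local Open Scope ring_scope.
Local Open Scope quotient_scope.

(* An associative unital algebra over a commutative ring R, presented as a    *)
(* ring A with a ring morphism from R to the center of A; the scalar action   *)
(* of c on x is [algmap c * x]. The library's [algType] cannot be used: it    *)
(* requires 1 != 0, which fails for a quotient by an improper ideal and for   *)
(* some tensor products of nonzero algebras.                                  *)
HB.mixin Record PzRing_isCentralAlgebra (R : pzRingType) A
    of GRing.PzRing A := {
  algmap : R -> A;
  algmap_zmod_morphism : zmod_morphism algmap;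
  algmap_monoid_morphism : monoid_morphism algmap;
  algmap_comm : forall c x, GRing.comm (algmap c) x
}.

#[short(type="pzAlgType")]
HB.structure Definition PzAlgebra (R : pzRingType) :=
  {A of GRing.PzRing A & PzRing_isCentralAlgebra R A}.

Section AlgMap.
Variables (R : pzRingType) (A : pzAlgType R).

HB.instance Definition _ := GRing.isZmodMorphism.Build R A algmap
  algmap_zmod_morphism.
HB.instance Definition _ := GRing.isMonoidMorphism.Build R A algmap
  algmap_monoid_morphism.

End AlgMap.

Definition alg_isomorphic (R : pzRingType) (A B : pzAlgType R) : Prop :=
  exists f : {rmorphism A -> B},
    (forall c : R, f (algmap c) = algmap c) /\ bijective f.

Section MatrixAlgebra.
Variables (R : comPzRingType) (n : nat).

Lemma scalar_mx_comm_mx (c : R) (M : 'M[R]_n) : GRing.comm c%:M M.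
Proof. exact/esym/scalar_mxC. Qed.

HB.instance Definition _ := PzRing_isCentralAlgebra.Build R 'M[R]_n
  (raddfB (@scalar_mx R n)) (erefl, @scalar_mxM R n) scalar_mx_comm_mx.

End MatrixAlgebra.

Section MonoidAlgebra.
Variables (R : comNzRingType) (K : monomType).

Lemma malgC_comm (c : R) (g : {malg R[K]}) : GRing.comm c%:MP g.
Proof.
rewrite /GRing.comm [g]monalgE mulr_suml mulr_sumr; apply: eq_bigr => k _.
by rewrite !malgM_def !fgmulUU mul1m mulm1 mulrC.
Qed.

Lemma malgC_monoid_morphism : monoid_morphism (@mkmalgU K R mone).
Proof. by have [malgCM malgC1] := malgC_is_multiplicative K R. Qed.

HB.instance Definition _ := PzRing_isCentralAlgebra.Build R {malg R[K]}
  (monalgUB mone) malgC_monoid_morphism malgC_comm.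

End MonoidAlgebra.

Section QuotientAlgebra.
Variables (R : pzRingType) (A : pzAlgType R) (S : A -> Prop).

(* The two-sided ideal of [A] generated by [S].                               *)
Inductive in_ideal : A -> Prop :=
| in_ideal0 : in_ideal 0
| in_idealMD a s b x : S s -> in_ideal x -> in_ideal (a * s * b + x).

Definition ideal : {pred A} := fun x => `[< in_ideal x >].

Lemma idealP x : reflect (in_ideal x) (x \in ideal).
Proof. exact: asboolP. Qed.

Lemma mem_ideal s : S s -> s \in ideal.
Proof.
move=> Ss; apply/idealP; rewrite -[s]addr0 -[s in s + _]mul1r -[1 * s]mulr1.
by apply: in_idealMD => //; apply: in_ideal0.
Qed.

Lemma ideal_mulr a x : x \in ideal -> a * x \in ideal.
Proof.
move=> /idealP Sx; apply/idealP.
elim: Sx => [|b s c z Ss _ IH]; first by rewrite mulr0; apply: in_ideal0.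
by rewrite mulrDr !mulrA; apply: in_idealMD.
Qed.

Lemma ideal_mull a x : x \in ideal -> x * a \in ideal.
Proof.
move=> /idealP Sx; apply/idealP.
elim: Sx => [|b s c z Ss _ IH]; first by rewrite mul0r; apply: in_ideal0.
by rewrite mulrDl -!mulrA mulrA; apply: in_idealMD.
Qed.

Lemma ideal_zmod_closed : zmod_closed ideal.
Proof.
split=> [|x y Sx Sy]; apply/idealP; first exact: in_ideal0.
elim: (idealP _ Sx) => [|b s c z Ss _ IH].
  by rewrite add0r -mulN1r; apply/idealP/ideal_mulr.
by rewrite -addrA; apply: in_idealMD.
Qed.

HB.instance Definition _ := GRing.isZmodClosed.Build A ideal ideal_zmod_closed.

Definition quotalg : Type := Quotient.quot ideal.

HB.instance Definition _ := Choice.on quotalg.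
HB.instance Definition _ := GRing.Zmodule.on quotalg.

Definition quotalg_pi (x : A) : quotalg := \pi_(Quotient.quot ideal) x.

Definition quotalg_one : quotalg := quotalg_pi 1.
Definition quotalg_mul (x y : quotalg) : quotalg :=
  quotalg_pi (repr (x : Quotient.quot ideal) * repr (y : Quotient.quot ideal)).

Lemma quotalg_piP (x : quotalg) : exists y, x = quotalg_pi y.
Proof.
by exists (repr (x : Quotient.quot ideal)); rewrite /quotalg_pi reprK.
Qed.

Lemma quotalg_eqP x y : reflect (quotalg_pi x = quotalg_pi y) (x - y \in ideal).
Proof. by rewrite Quotient.idealrBE; apply: eqP. Qed.

Lemma quotalg_pi_zmod_morphism : zmod_morphism quotalg_pi.
Proof. exact: raddfB. Qed.

HB.instance Definition _ := GRing.isZmodMorphism.Build A quotalg quotalg_pi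
  quotalg_pi_zmod_morphism.

Lemma quotalg_pi_mul : {morph quotalg_pi : x y / x * y >-> quotalg_mul x y}.
Proof.
move=> x y; apply/quotalg_eqP.
set x' := repr _; set y' := repr _.
rewrite -[x * y](addrNK (x * y')) -addrA -mulrBr -mulrBl rpredD //.
  by apply: ideal_mulr; apply/quotalg_eqP; rewrite /quotalg_pi reprK.
by apply: ideal_mull; apply/quotalg_eqP; rewrite /quotalg_pi reprK.
Qed.

Lemma quotalg_mulA : associative quotalg_mul.
Proof.
move=> x y z; have [[x' ->] [y' ->] [z' ->]] :=
  And3 (quotalg_piP x) (quotalg_piP y) (quotalg_piP z).
by rewrite -!quotalg_pi_mul mulrA.
Qed.

Lemma quotalg_mul1r : left_id quotalg_one quotalg_mul.
Proof.
by move=> x; have [x' ->] := quotalg_piP x; rewrite -quotalg_pi_mul mul1r.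
Qed.

Lemma quotalg_mulr1 : right_id quotalg_one quotalg_mul.
Proof.
by move=> x; have [x' ->] := quotalg_piP x; rewrite -quotalg_pi_mul mulr1.
Qed.

Lemma quotalg_mulDl : left_distributive quotalg_mul +%R.
Proof.
move=> x y z; have [[x' ->] [y' ->] [z' ->]] :=
  And3 (quotalg_piP x) (quotalg_piP y) (quotalg_piP z).
by rewrite -raddfD -!quotalg_pi_mul -raddfD mulrDl.
Qed.

Lemma quotalg_mulDr : right_distributive quotalg_mul +%R.
Proof.
move=> x y z; have [[x' ->] [y' ->] [z' ->]] :=
  And3 (quotalg_piP x) (quotalg_piP y) (quotalg_piP z).
by rewrite -raddfD -!quotalg_pi_mul -raddfD mulrDr.
Qed.

HB.instance Definition _ := GRing.Zmodule_isPzRing.Build quotalg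
  quotalg_mulA quotalg_mul1r quotalg_mulr1 quotalg_mulDl quotalg_mulDr.

HB.instance Definition _ := GRing.isMonoidMorphism.Build A quotalg quotalg_pi
  (erefl, quotalg_pi_mul).

Definition quotalg_map (c : R) : quotalg := quotalg_pi (algmap c).

Lemma quotalg_map_zmod_morphism : zmod_morphism quotalg_map.
Proof. by move=> c d; rewrite /quotalg_map !rmorphB. Qed.

Lemma quotalg_map_monoid_morphism : monoid_morphism quotalg_map.
Proof.
by split=> [|c d]; rewrite /quotalg_map ?rmorph1 // rmorphM rmorphM.
Qed.

Lemma quotalg_map_comm c x : GRing.comm (quotalg_map c) x.
Proof.
have [y ->] := quotalg_piP x.
by rewrite /GRing.comm -!rmorphM algmap_comm.
Qed.

HB.instance Definition _ := PzRing_isCentralAlgebra.Build R quotalg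
  quotalg_map_zmod_morphism quotalg_map_monoid_morphism quotalg_map_comm.

End QuotientAlgebra.

(* The tensor algebra of [V], that is, the direct sum of the tensor powers of *)
(* [V]. The monomial [:: v1; ...; vk] of the free algebra                     *)
(* [{malg R[{fmonom V}]}] on the underlying set of [V] stands for             *)
(* v1 (x) ... (x) vk; the ideal generated by the relations below is spanned   *)
(* by the elements that express multilinearity in v1, ..., vk.                *)
Section TensorAlgebra.
Variables (R : comNzRingType) (V : lmodType R).
Local Notation free := {malg R[{fmonom V}]}.
Local Notation gen v := (<< fmu v >> : free).

Inductive tensor_rel : free -> Prop :=
| Tensor_relD u v : tensor_rel (gen (u + v) - gen u - gen v)
| Tensor_relZ c v : tensor_rel (gen (c *: v) - c *: gen v).

Definition tensor_algebra : Type := quotalg tensor_rel.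

HB.instance Definition _ := PzAlgebra.on tensor_algebra.

Definition tensor_inj (v : V) : tensor_algebra := quotalg_pi tensor_rel (gen v).

End TensorAlgebra.

Section Clifford.
Variables (R : comNzRingType) (V : lmodType R) (Phi : V -> R).

Inductive clifford_rel : tensor_algebra V -> Prop :=
| Clifford_rel v :
    clifford_rel (tensor_inj v * tensor_inj v - algmap (Phi v)).

Definition clifford : Type := quotalg clifford_rel.

HB.instance Definition _ := PzAlgebra.on clifford.

Definition clifford_inj (v : V) : clifford :=
  quotalg_pi clifford_rel (tensor_inj v).

Lemma clifford_sq v : clifford_inj v * clifford_inj v = algmap (Phi v).
Proof. by rewrite -rmorphM; apply/quotalg_eqP/mem_ideal/Clifford_rel. Qed.

End Clifford.

Definition quadratic_form (R : pzRingType) (p q : nat)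
    (x : 'rV[R]_(p + q)) : R :=
  \sum_(i < p) x 0 (lshift q i) ^+ 2 - \sum_(j < q) x 0 (rshift p j) ^+ 2.

Definition Cl (R : comNzRingType) (p q : nat) : pzAlgType R :=
  clifford (@quadratic_form R p q).

Section LinearExtension.
Variables (R : comNzRingType) (K : choiceType) (M : lmodType R) (f : K -> M).

Definition linext (g : {malg R[K]}) : M := \sum_(k <- msupp g) g@_k *: f k.

Lemma linextEw (d : {fset K}) (g : {malg R[K]}) :
  (msupp g `<=` d)%fset -> linext g = \sum_(k <- d) g@_k *: f k.
Proof.
move=> le_gd; rewrite /linext (big_fset_incl _ le_gd) // => k _.
by move/mcoeff_outdom=> ->; rewrite scale0r.
Qed.

Lemma linext_is_linear : linear linext.
Proof.
move=> c g h; pose d := (msupp (c *: g + h) `|` msupp g `|` msupp h)%fset.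
have le_gd : (msupp g `<=` d)%fset by rewrite /d fsubsetU // fsubsetUr.
have le_hd : (msupp h `<=` d)%fset by rewrite /d fsubsetUr.
have le_ghd : (msupp (c *: g + h) `<=` d)%fset.
  by rewrite /d -fsetUA fsubsetUl.
rewrite (linextEw le_gd) (linextEw le_hd) (linextEw le_ghd) scaler_sumr.
rewrite -big_split.
by apply: eq_bigr => k _; rewrite mcoeffD mcoeffZ scalerDl scalerA.
Qed.

HB.instance Definition _ := GRing.isLinear.Build R {malg R[K]} M *:%R linext
  linext_is_linear.

Lemma linextU k : linext << k >> = f k.
Proof.
rewrite (linextEw (msuppU_le (k := k) (x := 1))) big_seq_fset1.
by rewrite mcoeffUU scale1r.
Qed.

End LinearExtension.

Section LinearFunctions.
Variables (R : comNzRingType) (K : choiceType).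
Implicit Types (U V W : lmodType R) (P : {malg R[K]} -> Prop).

Lemma malg_ind P :
  P 0 -> (forall c k g, P g -> P (c *: << k >> + g)) -> forall g, P g.
Proof.
move=> P0 PD g; rewrite [g]monalgE.
elim/big_rec: _ => // k h _ Ph.
suff -> : << g@_k *g k >> = g@_k *: << k >> :> {malg R[K]} by apply: PD.
by apply/malgP => k'; rewrite mcoeffZ !mcoeffU mulrnAr mulr1.
Qed.

Lemma linear_fun0 U V (f : U -> V) : linear f -> f 0 = 0.
Proof. by move/(_ (-1) 0 0); rewrite scaler0 addr0 scaleN1r addNr. Qed.

Lemma linear_funD U V (f : U -> V) : linear f -> {morph f : x y / x + y}.
Proof. by move=> lf x y; rewrite -[x in LHS]scale1r lf scale1r. Qed.

Lemma linear_funB U V (f : U -> V) : linear f -> {morph f : x y / x - y}.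
Proof. by move=> lf x y; rewrite addrC -scaleN1r lf scaleN1r addrC. Qed.

Lemma linear_funZ U V (f : U -> V) c : linear f -> {morph f : x / c *: x}.
Proof. by move=> lf x; rewrite -[c *: x]addr0 lf linear_fun0 // addr0. Qed.

Lemma linear_comp U V W (f : V -> W) (g : U -> V) :
  linear f -> linear g -> linear (fun x => f (g x)).
Proof. by move=> lf lg c x y; rewrite lg lf. Qed.

Lemma malg_linear_ext V (f g : {malg R[K]} -> V) :
  linear f -> linear g -> (forall k, f << k >> = g << k >>) -> f =1 g.
Proof.
move=> lf lg fg; elim/malg_ind => [|c k h IH]; last by rewrite lf lg fg IH.
by rewrite !linear_fun0.
Qed.

End LinearFunctions.

Section Span.
Variables (R : pzRingType) (M : lmodType R) (S : M -> Prop).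

Inductive in_lin_span : M -> Prop :=
| in_lin_span0 : in_lin_span 0
| in_lin_spanZD c s x : S s -> in_lin_span x -> in_lin_span (c *: s + x).

Definition lin_span : {pred M} := fun x => `[< in_lin_span x >].

Lemma lin_spanP x : reflect (in_lin_span x) (x \in lin_span).
Proof. exact: asboolP. Qed.

Lemma lin_span_submod_closed : submod_closed lin_span.
Proof.
split=> [|c x y /lin_spanP Sx /lin_spanP Sy]; apply/lin_spanP.
  exact: in_lin_span0.
elim: Sx => [|b s z Ss _ IH]; first by rewrite scaler0 add0r.
by rewrite scalerDr scalerA -addrA; apply: in_lin_spanZD.
Qed.

HB.instance Definition _ := GRing.isSubmodClosed.Build R M lin_span
  lin_span_submod_closed.

Lemma mem_lin_span s : S s -> s \in lin_span.
Proof.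
move=> Ss; apply/lin_spanP; rewrite -[s]addr0 -[s in s + _]scale1r.
by apply: in_lin_spanZD => //; apply: in_lin_span0.
Qed.

End Span.

(* The tensor product of the underlying modules of [A] and [B] is the free    *)
(* module on the set A * B modulo the submodule spanned by the bilinearity    *)
(* relations; its product is induced by (a, a') (b, b') = (a b, a' b').       *)
Section TensorProduct.
Variables (R : comNzRingType) (A B : pzAlgType R).
Local Notation free := {malg R[(A * B)%type]}.
Local Notation gen a b := (<< (a, b) >> : free).

Inductive bilinear_rel : free -> Prop :=
| Bilinear_relDl a a' b : bilinear_rel (gen (a + a') b - gen a b - gen a' b)
| Bilinear_relDr a b b' : bilinear_rel (gen a (b + b') - gen a b - gen a b')
| Bilinear_relZl c a b : bilinear_rel (gen (algmap c * a) b - c *: gen a b)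
| Bilinear_relZr c a b : bilinear_rel (gen a (algmap c * b) - c *: gen a b).

Definition free_mul (g h : free) : free :=
  linext (fun x => linext (fun y => gen (x.1 * y.1) (x.2 * y.2)) h) g.

Lemma free_mul_linearl h : linear (free_mul^~ h).
Proof. exact: linearP. Qed.

Lemma free_mul_linearr g : linear (free_mul g).
Proof.
move=> c h h'; rewrite /free_mul /linext scaler_sumr -big_split.
apply: eq_bigr => k _ /=; rewrite -![\sum_(_ <- msupp _) _]/(linext _ _).
by rewrite linearP scalerDr !scalerA mulrC.
Qed.

Lemma free_mulUU a a' b b' :
  free_mul (gen a a') (gen b b') = gen (a * b) (a' * b').
Proof. by rewrite /free_mul !linextU. Qed.

Lemma free_mulA : associative free_mul.
Proof.
move=> g h l; move: g; apply: malg_linear_ext.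
- exact: free_mul_linearl.
- exact: linear_comp (free_mul_linearl l) (free_mul_linearl h).
case=> a a'; move: h; apply: malg_linear_ext.
- exact: linear_comp (free_mul_linearr _) (free_mul_linearl l).
- exact: linear_comp (free_mul_linearl l) (free_mul_linearr _).
case=> b b'; move: l; apply: malg_linear_ext.
- exact: linear_comp (free_mul_linearr _) (free_mul_linearr _).
- exact: free_mul_linearr.
by case=> c c'; rewrite !free_mulUU !mulrA.
Qed.

Lemma free_mul1r : left_id (gen 1 1) free_mul.
Proof.
apply: malg_linear_ext => [||[a a']]; [exact: free_mul_linearr | by [] | ].
by rewrite free_mulUU !mul1r.
Qed.

Lemma free_mulr1 : right_id (gen 1 1) free_mul.
Proof.
apply: malg_linear_ext => [||[a a']]; [exact: free_mul_linearl | by [] | ].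
by rewrite free_mulUU !mulr1.
Qed.

Lemma free_mulDl g g' h : free_mul (g + g') h = free_mul g h + free_mul g' h.
Proof. exact: linear_funD (free_mul_linearl h) g g'. Qed.

Lemma free_mulDr g h h' : free_mul g (h + h') = free_mul g h + free_mul g h'.
Proof. exact: linear_funD (free_mul_linearr g) h h'. Qed.

Lemma free_mulBl g g' h : free_mul (g - g') h = free_mul g h - free_mul g' h.
Proof. exact: linear_funB (free_mul_linearl h) g g'. Qed.

Lemma free_mulBr g h h' : free_mul g (h - h') = free_mul g h - free_mul g h'.
Proof. exact: linear_funB (free_mul_linearr g) h h'. Qed.

Lemma free_mulZl c g h : free_mul (c *: g) h = c *: free_mul g h.
Proof. exact: linear_funZ c (free_mul_linearl h) g. Qed.

Lemma free_mulZr c g h : free_mul g (c *: h) = c *: free_mul g h.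
Proof. exact: linear_funZ c (free_mul_linearr g) h. Qed.

Local Notation N := (lin_span bilinear_rel).

Lemma span_linear (f : free -> free) : linear f ->
  (forall g, bilinear_rel g -> f g \in N) -> forall g, g \in N -> f g \in N.
Proof.
move=> lf fN g /lin_spanP; elim=> [|c s h Ss _ IH].
  by rewrite linear_fun0 // rpred0.
by rewrite lf rpredD // rpredZ // fN.
Qed.

Lemma basis_linear (f : free -> free) : linear f ->
  (forall a b, f (gen a b) \in N) -> forall g, f g \in N.
Proof.
move=> lf fN; apply: malg_ind => [|c [a b] h IH].
  by rewrite linear_fun0 // rpred0.
by rewrite lf rpredD // rpredZ.
Qed.

Lemma span_mull g h : g \in N -> free_mul g h \in N.
Proof.
move: g; apply: span_linear => [|g Sg]; first exact: free_mul_linearl.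
move: h; apply: basis_linear => [|u v]; first exact: free_mul_linearr.
apply: mem_lin_span; case: Sg => [a a' b|a b b'|c a b|c a b].
- by rewrite !free_mulBl !free_mulUU mulrDl; apply: Bilinear_relDl.
- by rewrite !free_mulBl !free_mulUU mulrDl; apply: Bilinear_relDr.
- by rewrite free_mulBl free_mulZl !free_mulUU -mulrA; apply: Bilinear_relZl.
- by rewrite free_mulBl free_mulZl !free_mulUU -mulrA; apply: Bilinear_relZr.
Qed.

Lemma span_mulr g h : h \in N -> free_mul g h \in N.
Proof.
move: h; apply: span_linear => [|h Sh]; first exact: free_mul_linearr.
move: g; apply: basis_linear => [|u v]; first exact: free_mul_linearl.
apply: mem_lin_span; case: Sh => [a a' b|a b b'|c a b|c a b].
- by rewrite !free_mulBr !free_mulUU mulrDr; apply: Bilinear_relDl.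
- by rewrite !free_mulBr !free_mulUU mulrDr; apply: Bilinear_relDr.
- rewrite free_mulBr free_mulZr !free_mulUU mulrA -(algmap_comm c u) -mulrA.
  exact: Bilinear_relZl.
- rewrite free_mulBr free_mulZr !free_mulUU mulrA -(algmap_comm c v) -mulrA.
  exact: Bilinear_relZr.
Qed.

Definition tensor_product : Type := Quotient.quot N.

HB.instance Definition _ := Choice.on tensor_product.
HB.instance Definition _ := GRing.Zmodule.on tensor_product.

Definition tensor_pi (g : free) : tensor_product := \pi_(Quotient.quot N) g.

Definition tensor (a : A) (b : B) : tensor_product := tensor_pi (gen a b).

Definition tensor_mul (x y : tensor_product) : tensor_product :=
  tensor_pi (free_mul (repr (x : Quotient.quot N))
                      (repr (y : Quotient.quot N))).

Lemma tensor_piP (x : tensor_product) : exists g, x = tensor_pi g.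
Proof. by exists (repr (x : Quotient.quot N)); rewrite /tensor_pi reprK. Qed.

Lemma tensor_eqP g h : reflect (tensor_pi g = tensor_pi h) (g - h \in N).
Proof. by rewrite Quotient.idealrBE; apply: eqP. Qed.

Lemma tensor_pi_zmod_morphism : zmod_morphism tensor_pi.
Proof. exact: raddfB. Qed.

HB.instance Definition _ := GRing.isZmodMorphism.Build free tensor_product
  tensor_pi tensor_pi_zmod_morphism.

Lemma tensor_pi_mul g h :
  tensor_pi (free_mul g h) = tensor_mul (tensor_pi g) (tensor_pi h).
Proof.
apply/tensor_eqP; set g' := repr _; set h' := repr _.
rewrite -[free_mul g h](addrNK (free_mul g h')) -addrA rpredD //.
  rewrite -free_mulBr; apply: span_mulr; apply/tensor_eqP.
  by rewrite /tensor_pi reprK.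
rewrite -free_mulBl; apply: span_mull; apply/tensor_eqP.
by rewrite /tensor_pi reprK.
Qed.

Lemma tensor_mulA : associative tensor_mul.
Proof.
move=> x y z; have [[g ->] [h ->] [l ->]] :=
  And3 (tensor_piP x) (tensor_piP y) (tensor_piP z).
by rewrite -!tensor_pi_mul free_mulA.
Qed.

Lemma tensor_mul1r : left_id (tensor 1 1) tensor_mul.
Proof.
by move=> x; have [g ->] := tensor_piP x; rewrite -tensor_pi_mul free_mul1r.
Qed.

Lemma tensor_mulr1 : right_id (tensor 1 1) tensor_mul.
Proof.
by move=> x; have [g ->] := tensor_piP x; rewrite -tensor_pi_mul free_mulr1.
Qed.

Lemma tensor_mulDl : left_distributive tensor_mul +%R.
Proof.
move=> x y z; have [[g ->] [h ->] [l ->]] :=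
  And3 (tensor_piP x) (tensor_piP y) (tensor_piP z).
by rewrite -raddfD -!tensor_pi_mul free_mulDl raddfD.
Qed.

Lemma tensor_mulDr : right_distributive tensor_mul +%R.
Proof.
move=> x y z; have [[g ->] [h ->] [l ->]] :=
  And3 (tensor_piP x) (tensor_piP y) (tensor_piP z).
by rewrite -raddfD -!tensor_pi_mul free_mulDr raddfD.
Qed.

HB.instance Definition _ := GRing.Zmodule_isPzRing.Build tensor_product
  tensor_mulA tensor_mul1r tensor_mulr1 tensor_mulDl tensor_mulDr.

Lemma tensorM a a' b b' :
  tensor a a' * tensor b b' = tensor (a * b) (a' * b').
Proof. by rewrite -[LHS]tensor_pi_mul free_mulUU. Qed.

Lemma tensorDl a a' b : tensor (a + a') b = tensor a b + tensor a' b.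
Proof.
rewrite -raddfD; apply/tensor_eqP; rewrite opprD addrA.
exact/mem_lin_span/Bilinear_relDl.
Qed.

Lemma tensorDr a b b' : tensor a (b + b') = tensor a b + tensor a b'.
Proof.
rewrite -raddfD; apply/tensor_eqP; rewrite opprD addrA.
exact/mem_lin_span/Bilinear_relDr.
Qed.

Lemma tensorZ c a b : tensor (algmap c * a) b = tensor a (algmap c * b).
Proof.
transitivity (tensor_pi (c *: gen a b)); last apply: esym.
  exact/tensor_eqP/mem_lin_span/Bilinear_relZl.
exact/tensor_eqP/mem_lin_span/Bilinear_relZr.
Qed.

Definition tensor_map (c : R) : tensor_product := tensor (algmap c) 1.

Lemma tensor_mapE c : tensor_map c = tensor_pi (c *: gen 1 1).
Proof.
rewrite /tensor_map -[algmap c]mulr1.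
exact/tensor_eqP/mem_lin_span/Bilinear_relZl.
Qed.

Lemma tensor_map_zmod_morphism : zmod_morphism tensor_map.
Proof. by move=> c d; rewrite !tensor_mapE scalerBl raddfB. Qed.

Lemma tensor_map_monoid_morphism : monoid_morphism tensor_map.
Proof.
split=> [|c d]; first by rewrite /tensor_map rmorph1.
by rewrite /tensor_map tensorM rmorphM mulr1.
Qed.

Lemma tensor_map_comm c x : GRing.comm (tensor_map c) x.
Proof.
have [g ->] := tensor_piP x; rewrite /GRing.comm tensor_mapE.
rewrite -[LHS]tensor_pi_mul -[RHS]tensor_pi_mul free_mulZl free_mulZr.
by rewrite free_mul1r free_mulr1.
Qed.

HB.instance Definition _ := PzRing_isCentralAlgebra.Build R tensor_product
  tensor_map_zmod_morphism tensor_map_monoid_morphism tensor_map_comm.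

End TensorProduct.

(* Main.v *)
(* Write w for the product of an orthonormal basis of the 8-dimensional definite
   space W. Then w^2 = 1 and w anticommutes with every vector of W, whence
   (x, y) |-> x (x) w + 1 (x) y extends to a morphism from the Clifford algebra of
   U + W to Cl(U) (x) Cl(W); its inverse sends x (x) 1 to x w and 1 (x) y to y.

   For Cl(W) = R(16), let P be the product of the projectors (1 + S) / 2 for four
   commuting words S of length 4 in the basis vectors e_0, ..., e_7, given by the
   extended Hamming code; S^2 = 1 for either sign of the form. If X_i runs over
   the 16 products of e_0, ..., e_3, the elements X_i P X_j^-1 form a system of
   matrix units, and e_k X_i P = +- X_j P for some j. So each e_k is a combination
   of the matrix units, whose coefficients form a signed permutation matrix; these
   matrices represent Cl(W), and the two morphisms are inverse to each other. All
   the identities between words in the e_k are checked by computation. *)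
From HB Require Import structures.
Require Import Defs.
From mathcomp Require Import all_boot all_order all_algebra.
From mathcomp Require Import reals.
From mathcomp.multinomials Require Import monalg.

Set Implicit Arguments.
Unset Strict Implicit.
Unset Printing Implicit Defensive.

Import GRing.Theory.
Local Open Scope ring_scope.

(** * Universal properties *)

Section AlgebraMorphisms.
Variable R : pzRingType.
Implicit Types A B C : pzAlgType R.

Record alghom A B := AlgHom {
  alghom_rmorphism :> {rmorphism A -> B};
  alghom_algmap : forall c, alghom_rmorphism (algmap c) = algmap c
}.

(** Existence together with a pointwise equation keeps the construction of the morphism opaque to
    its users, here and in the lifting lemmas below. *)
Lemma alghomP A B (f : A -> B) :
  zmod_morphism f -> monoid_morphism f -> (forall c, f (algmap c) = algmap c) ->
  exists F : alghom A B, F =1 f.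
Proof.
move=> fB fM fc.
pose F := HB.pack_for {rmorphism A -> B} f
  (GRing.isZmodMorphism.Build _ _ f fB) (GRing.isMonoidMorphism.Build _ _ f fM).
by exists (@AlgHom A B F fc).
Qed.

Lemma alghom_comp A B C (F : alghom B C) (G : alghom A B) :
  exists H : alghom A C, H =1 F \o G.
Proof.
exists (@AlgHom A C (F \o G : {rmorphism A -> C})
          (fun c => etrans (congr1 F (alghom_algmap G c)) (alghom_algmap F c))).
by [].
Qed.

Lemma alg_iso_of_cancel A B (F : alghom A B) (G : alghom B A) :
  cancel F G -> cancel G F -> alg_isomorphic A B.
Proof.
move=> FK GK; exists F; split; first exact: alghom_algmap.
by exists G.
Qed.

Lemma alg_isomorphic_sym A B : alg_isomorphic A B -> alg_isomorphic B A.
Proof.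
move=> [F [Fc [G FK GK]]].
have [||c|H HG] := @alghomP B A G.
- exact: can2_zmod_morphism FK GK.
- exact: can2_monoid_morphism FK GK.
- by rewrite -Fc FK.
by apply: (@alg_iso_of_cancel B A H (AlgHom Fc)) => x /=; rewrite HG ?FK ?GK.
Qed.

Lemma alg_isomorphic_trans A B C :
  alg_isomorphic A B -> alg_isomorphic B C -> alg_isomorphic A C.
Proof.
move=> [F [Fc bijF]] [G [Gc bijG]].
exists (G \o F : {rmorphism A -> C}); split; last exact: bij_comp.
by move=> c /=; rewrite Fc Gc.
Qed.

(** The lift applies [f] to a chosen representative. Since [f] kills [S], it kills all sums of
    products a s b, so the choice does not matter. *)
Lemma quotalg_lift A B (S : A -> Prop) (f : alghom A B) :
  (forall s, S s -> f s = 0) ->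
  exists F : alghom (quotalg S) B, forall x, F (quotalg_pi S x) = f x.
Proof.
move=> fS.
pose F (x : quotalg S) :=
  f (generic_quotient.repr (x : Quotient.quot (ideal S))).
have F_pi x : F (quotalg_pi S x) = f x.
  apply/eqP; rewrite -subr_eq0 -rmorphB; apply/eqP.
  set y := _ - x; have /idealP : y \in ideal S.
    by apply/quotalg_eqP; rewrite /quotalg_pi generic_quotient.reprK.
  elim=> [|a s b z Ss _ IH]; first exact: rmorph0.
  by rewrite rmorphD !rmorphM (fS s Ss) mulr0 mul0r add0r.
have [||c|G GF] := @alghomP (quotalg S) B F.
- move=> x y; have [x' ->] := quotalg_piP x; have [y' ->] := quotalg_piP y.
  by rewrite -rmorphB !F_pi rmorphB.
- split=> [|x y]; first by rewrite -(rmorph1 (quotalg_pi S)) F_pi rmorph1.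
  have [x' ->] := quotalg_piP x; have [y' ->] := quotalg_piP y.
  by rewrite -rmorphM !F_pi rmorphM.
- by rewrite F_pi alghom_algmap.
by exists G => x; rewrite GF F_pi.
Qed.

(* Turns the action [algmap c * x] into the scaling of an [lmodType], so that
   linearity of maps into [A] can be stated and [linext] applies to [A]. *)
Definition alg_module A : Type := A.
HB.instance Definition _ A := GRing.Zmodule.on (alg_module A).

Definition alg_scale A (c : R) (x : alg_module A) : alg_module A :=
  algmap c * (x : A).

Fact alg_scaleA A a b (x : alg_module A) :
  alg_scale a (alg_scale b x) = alg_scale (a * b) x.
Proof. by rewrite /alg_scale mulrA rmorphM. Qed.
Fact alg_scale1 A : left_id 1 (@alg_scale A).
Proof. by move=> x; rewrite /alg_scale rmorph1 mul1r. Qed.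
Fact alg_scaleDr A : right_distributive (@alg_scale A) +%R.
Proof. by move=> c x y; rewrite /alg_scale mulrDr. Qed.
Fact alg_scaleDl A (x : alg_module A) :
  {morph (@alg_scale A)^~ x : a b / a + b}.
Proof. by move=> a b; rewrite /alg_scale rmorphD mulrDl. Qed.

HB.instance Definition _ A := GRing.Zmodule_isLmodule.Build R (alg_module A)
  (@alg_scaleA A) (@alg_scale1 A) (@alg_scaleDr A) (@alg_scaleDl A).

Lemma alg_moduleZ A c (x : alg_module A) : c *: x = algmap c * (x : A) :> A.
Proof. by []. Qed.

End AlgebraMorphisms.

(** * Lifting and induction for monoid algebras and Clifford algebras *)

Section FreeLift.
Variable R : comNzRingType.
Implicit Type A : pzAlgType R.

Lemma alg_mull_linear A (x : A) :
  linear (fun y : alg_module A => x * (y : A) : alg_module A).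
Proof.
move=> c y z; rewrite !alg_moduleZ mulrDr mulrA -(algmap_comm c x).
by rewrite -mulrA.
Qed.

Lemma alg_mulr_linear A (x : A) :
  linear (fun y : alg_module A => (y : A) * x : alg_module A).
Proof. by move=> c y z; rewrite !alg_moduleZ mulrDl mulrA. Qed.

Lemma algmap_anticomm A c (x y : A) :
  x * y = - (y * x) -> x * (algmap c * y) = - (algmap c * y * x).
Proof. by move=> xy; rewrite mulrA -(algmap_comm c) -!mulrA xy mulrN. Qed.

Lemma malg_algmapE (K : monomType) c : 
  algmap c = c *: (<< @mone K >> : {malg R[K]}).
Proof.
by apply/malgP => k; rewrite mcoeffZ !mcoeffU mulrnAr mulr1.
Qed.

Lemma malg_algmapM (K : monomType) c (g : {malg R[K]}) : algmap c * g = c *: g.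
Proof. exact: mul_malgC. Qed.

(** Universal property of the monoid algebra: both sides of the multiplicativity equation are
    bilinear, so it suffices to compare them on monomials. *)
Lemma malg_lift (K : monomType) A (h : K -> A) :
  h mone = 1 -> {morph h : m n / mmul m n >-> m * n} ->
  exists F : alghom {malg R[K]} A, forall m, F << m >> = h m.
Proof.
move=> h1 hM; pose F := linext (h : K -> alg_module A).
have lF : linear F by exact: linearP.
have FU m : F << m >> = h m by exact: linextU.
have [||c|G GF] := @alghomP R {malg R[K]} A F.
- exact: linear_funB lF.
- split=> [|g g']; first by rewrite FU.
  move: g; apply: (@malg_linear_ext R K (alg_module A)
    (fun g => F (g * g')) (fun g => (F g : A) * F g')).
  + by move=> c g h'; rewrite mulrDl -scalerAl lF.
  + exact: linear_comp (alg_mulr_linear _) lF.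
  move=> k; move: g'; apply: (@malg_linear_ext R K (alg_module A)
    (fun g' => F (<< k >> * g')) (fun g' => (F << k >> : A) * F g')).
  + move=> c g h'; rewrite mulrDr -malg_algmapM mulrA -(algmap_comm c) -mulrA.
    by rewrite malg_algmapM lF.
  + exact: linear_comp (alg_mull_linear _) lF.
  by move=> k'; rewrite malgM_def fgmulUU mulr1 !FU hM.
- by rewrite malg_algmapE (linear_funZ _ lF) FU h1 alg_moduleZ mulr1.
by exists G => m; rewrite GF FU.
Qed.

Lemma fmonom_ind (I : choiceType) (P : {fmonom I} -> Prop) :
  P mone -> (forall i m, P m -> P (mmul (fmu i) m)) -> forall m, P m.
Proof.
move=> P1 PM m; have -> : m = FMonom m by rewrite fmK.
elim: (m : seq I) => [|i s IH].
  by have -> : FMonom [::] = mone :> {fmonom I} by apply: val_inj; rewrite /= fm1.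
have -> : FMonom (i :: s) = mmul (fmu i) (FMonom s).
  by apply: val_inj; rewrite /= fmM fmU.
exact: PM.
Qed.

Lemma free_lift (V : choiceType) A (f : V -> A) :
  exists F : alghom {malg R[{fmonom V}]} A, forall v, F << fmu v >> = f v.
Proof.
have [||F FE] := @malg_lift _ A (fun m : {fmonom V} => \prod_(v <- m) f v).
- by rewrite fm1 big_nil.
- by move=> m n; rewrite fmM big_cat.
by exists F => v; rewrite FE fmU big_seq1.
Qed.

Lemma free_ind (V : choiceType) (P : {malg R[{fmonom V}]} -> Prop) :
  (forall c, P (algmap c)) -> (forall v, P << fmu v >>) ->
  (forall x y, P x -> P y -> P (x + y)) ->
  (forall x y, P x -> P y -> P (x * y)) -> forall x, P x.
Proof.
move=> Pc Pv PD PM; elim/malg_ind => [|c m g Pg].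
  by have := Pc 0; rewrite rmorph0.
apply: (PD) => //; rewrite -malg_algmapM; apply: (PM) => //.
elim/fmonom_ind: m => [|v m Pm]; first by have := Pc 1; rewrite rmorph1.
suff -> : << mmul (fmu v) m >> = << fmu v >> * << m >> :> {malg R[{fmonom V}]}.
  exact: PM.
by rewrite malgM_def fgmulUU mulr1.
Qed.

Variable V : lmodType R.

(** The morphism that [f] induces on the free algebra descends twice: linearity of [f] kills the
    tensor relations, and the square condition kills the Clifford relations. *)
Lemma clifford_lift (Phi : V -> R) A (f : V -> alg_module A) :
  linear f -> (forall v, (f v : A) * f v = algmap (Phi v)) ->
  exists F : alghom (clifford Phi) A, forall v, F (clifford_inj Phi v) = f v.
Proof.
move=> lf fQ; have [F0 F0E] := free_lift (f : V -> A).
have [|F1 F1E] := @quotalg_lift R _ A (@tensor_rel R V) F0.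
  move=> _ [u v|c v].
    by rewrite !rmorphB !F0E (linear_funD lf) addrAC addrK subrr.
  rewrite rmorphB -malg_algmapM rmorphM alghom_algmap !F0E (linear_funZ c lf).
  by rewrite subrr.
have [|F FE] := @quotalg_lift R _ A (@clifford_rel R V Phi) F1.
  move=> _ [v]; rewrite rmorphB rmorphM alghom_algmap.
  by rewrite F1E F0E fQ subrr.
by exists F => v; rewrite FE F1E F0E.
Qed.

Lemma clifford_ind (Phi : V -> R) (P : clifford Phi -> Prop) :
  (forall c, P (algmap c)) -> (forall v, P (clifford_inj Phi v)) ->
  (forall x y, P x -> P y -> P (x + y)) ->
  (forall x y, P x -> P y -> P (x * y)) -> forall x, P x.
Proof.
move=> Pc Pv PD PM x; have [y ->] := quotalg_piP x.
have [z ->] := quotalg_piP y; elim/free_ind: z => [c|v|z z' Pz Pz'|z z' Pz Pz'].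
- exact: Pc.
- exact: Pv.
- by rewrite !raddfD; apply: PD.
- by rewrite !quotalg_pi_mul; apply: PM.
Qed.

Lemma clifford_ext (Phi : V -> R) A (F G : alghom (clifford Phi) A) :
  (forall v, F (clifford_inj Phi v) = G (clifford_inj Phi v)) -> F =1 G.
Proof.
move=> FG; elim/clifford_ind => [c|v|x y IHx IHy|x y IHx IHy].
- by rewrite !alghom_algmap.
- exact: FG.
- by rewrite (rmorphD F) (rmorphD G) IHx IHy.
- by rewrite (rmorphM F) (rmorphM G) IHx IHy.
Qed.

(** The centralizer of [y] is a subalgebra, and the vectors generate the Clifford algebra. *)
Lemma clifford_hom_comm (Phi : V -> R) A (F : alghom (clifford Phi) A) (y : A) :
  (forall v, GRing.comm y (F (clifford_inj Phi v))) -> forall x, GRing.comm y (F x).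
Proof.
move=> Fy; elim/clifford_ind => [c|v|x z IHx IHz|x z IHx IHz].
- by rewrite alghom_algmap; apply/commr_sym/algmap_comm.
- exact: Fy.
- by rewrite raddfD; apply: commrD.
- by rewrite rmorphM; apply: commrM.
Qed.

End FreeLift.

(** Polarization: the cross terms x y + y x must vanish. *)
Lemma anticomm_of_sqrD (A : pzRingType) (x y : A) :
  (x + y) * (x + y) = x * x + y * y -> x * y = - (y * x).
Proof.
rewrite mulrDl !mulrDr => E; apply/eqP; rewrite -addr_eq0; apply/eqP.
by apply: (addrI (x * x)); apply: (addIr (y * y)); rewrite addr0 -E !addrA.
Qed.

(** * Relations among vectors in a Clifford algebra *)

Section CliffordInjection.
Variables (R : comNzRingType) (V : lmodType R) (Phi : V -> R).

Lemma tensor_injD (u v : V) : tensor_inj (u + v) = tensor_inj u + tensor_inj v.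
Proof.
rewrite -rmorphD; apply/quotalg_eqP; rewrite opprD addrA.
exact/mem_ideal/Tensor_relD.
Qed.

Lemma tensor_injZ c (v : V) : tensor_inj (c *: v) = algmap c * tensor_inj v.
Proof.
transitivity (quotalg_pi (@tensor_rel R V) (c *: << fmu v >>)); last first.
  by rewrite -malg_algmapM rmorphM.
exact/quotalg_eqP/mem_ideal/Tensor_relZ.
Qed.

Lemma clifford_injD u v :
  clifford_inj Phi (u + v) = clifford_inj Phi u + clifford_inj Phi v.
Proof. by rewrite /clifford_inj tensor_injD rmorphD. Qed.

Lemma clifford_injZ c v :
  clifford_inj Phi (c *: v) = algmap c * clifford_inj Phi v.
Proof. by rewrite /clifford_inj tensor_injZ quotalg_pi_mul. Qed.

Lemma clifford_inj_linear :
  linear (clifford_inj Phi : V -> alg_module (clifford Phi)).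
Proof. by move=> c u v; rewrite clifford_injD clifford_injZ. Qed.

(** Orthogonality of [u] and [v] is expressed by additivity of [Phi] on this pair. *)
Lemma clifford_inj_anticomm u v : Phi (u + v) = Phi u + Phi v ->
  clifford_inj Phi u * clifford_inj Phi v =
  - (clifford_inj Phi v * clifford_inj Phi u).
Proof.
move=> uv; apply: anticomm_of_sqrD; rewrite !clifford_sq -clifford_injD.
by rewrite clifford_sq uv rmorphD.
Qed.

End CliffordInjection.

(** * Universal property of the tensor product of algebras *)

Section TensorProduct.
Variables (R : comNzRingType) (A B C : pzAlgType R).

Lemma tensor_algmapl c : tensor (algmap c) 1 = algmap c :> tensor_product A B.
Proof. by []. Qed.

Lemma tensor_algmapr c : tensor 1 (algmap c) = algmap c :> tensor_product A B.
Proof. by rewrite -tensor_algmapl -[in RHS](mulr1 (algmap c)) tensorZ mulr1. Qed.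

Lemma tensorZl c (a : A) (b : B) : tensor (algmap c * a) b = algmap c * tensor a b.
Proof. by rewrite -tensor_algmapl tensorM mul1r. Qed.

Lemma tensorl_linear b :
  linear (fun a : alg_module A => tensor (a : A) b : alg_module (tensor_product A B)).
Proof. by move=> c a a'; rewrite !alg_moduleZ tensorDl tensorZl. Qed.

Lemma tensorr_linear a :
  linear (fun b : alg_module B => tensor a (b : B) : alg_module (tensor_product A B)).
Proof. by move=> c b b'; rewrite !alg_moduleZ tensorDr -tensorZ tensorZl. Qed.

Lemma tensor0r a : tensor a 0 = 0 :> tensor_product A B.
Proof. exact: linear_fun0 (tensorr_linear a). Qed.

Lemma tensor0l b : tensor 0 b = 0 :> tensor_product A B.
Proof. exact: linear_fun0 (tensorl_linear b). Qed.

(** The cross terms are a (x) w b and a (x) b w, which cancel. The twist by [w] thus makes the two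
    summands anticommute although the tensor product is ungraded. *)
Lemma tensor_sqrD (a : A) (b w : B) : w * w = 1 -> w * b = - (b * w) ->
  (tensor a w + tensor 1 b) * (tensor a w + tensor 1 b) =
  tensor (a * a) 1 + tensor 1 (b * b).
Proof.
move=> w_sq wb; rewrite mulrDl !mulrDr !tensorM !mul1r !mulr1 w_sq wb addrA.
by rewrite -(addrA (tensor (a * a) 1)) -tensorDr addNr tensor0r addr0.
Qed.

Lemma tensor_homl : exists F : alghom A (tensor_product A B),
  forall a, F a = tensor a 1.
Proof.
apply: alghomP => //; last by split=> // a a'; rewrite tensorM mulr1.
move=> a a'; apply/eqP; rewrite -subr_eq opprK -tensorDl; apply/eqP.
by rewrite subrK.
Qed.

Lemma tensor_homr : exists F : alghom B (tensor_product A B),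
  forall b, F b = tensor 1 b.
Proof.
apply: alghomP; last exact: tensor_algmapr; last first.
  by split=> // b b'; rewrite tensorM mulr1.
move=> b b'; apply/eqP; rewrite -subr_eq opprK -tensorDr; apply/eqP.
by rewrite subrK.
Qed.

(** The expression f(a) g(b) is bilinear, hence respects the relations; it is multiplicative because
    the images of [f] and [g] commute. *)
Lemma tensor_lift (f : alghom A C) (g : alghom B C) :
  (forall a b, GRing.comm (f a) (g b)) ->
  exists F : alghom (tensor_product A B) C,
    forall a b, F (tensor a b) = f a * g b.
Proof.
move=> fg.
pose F0 := linext (fun x : A * B => f x.1 * g x.2 : alg_module C).
have lF0 : linear F0 by exact: linearP.
have F0U a b : F0 << (a, b) >> = f a * g b by rewrite /F0 linextU.
pose F (x : tensor_product A B) :=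
  F0 (generic_quotient.repr (x : Quotient.quot (lin_span (@bilinear_rel R A B)))).
have F_pi x : F (tensor_pi x) = F0 x.
  apply/eqP; rewrite -subr_eq0 -(linear_funB lF0); apply/eqP.
  set y := _ - x; have /lin_spanP : y \in lin_span (@bilinear_rel R A B).
    by apply/tensor_eqP; rewrite /tensor_pi generic_quotient.reprK.
  elim=> [|c s z Ss _ IH]; first exact: linear_fun0 lF0.
  rewrite lF0 IH addr0 alg_moduleZ.
  suff -> : F0 s = 0 by rewrite mulr0.
  case: Ss => {c s z IH} [a a' b|a b b'|c a b|c a b].
  - by rewrite !(linear_funB lF0) !F0U rmorphD mulrDl addrAC addrK subrr.
  - by rewrite !(linear_funB lF0) !F0U rmorphD mulrDr addrAC addrK subrr.
  - rewrite (linear_funB lF0) (linear_funZ _ lF0) !F0U rmorphM alghom_algmap.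
    by rewrite alg_moduleZ mulrA subrr.
  rewrite (linear_funB lF0) (linear_funZ _ lF0) !F0U rmorphM alghom_algmap.
  by rewrite alg_moduleZ mulrA -algmap_comm -mulrA subrr.
have F_tensor a b : F (tensor a b) = f a * g b by rewrite F_pi F0U.
have [||c|G GF] := @alghomP R (tensor_product A B) C F.
- move=> x y; have [x' ->] := tensor_piP x; have [y' ->] := tensor_piP y.
  by rewrite -raddfB !F_pi (linear_funB lF0).
- split=> [|x y]; first by rewrite F_tensor !rmorph1 mulr1.
  have [x' ->] := tensor_piP x; have [y' ->] := tensor_piP y.
  rewrite -[tensor_pi _ * _]tensor_pi_mul !F_pi.
  move: x'; apply: (@malg_linear_ext R _ (alg_module C)
    (fun z => F0 (free_mul z y')) (fun z => (F0 z : C) * F0 y')).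
  + exact: linear_comp lF0 (free_mul_linearl _).
  + exact: linear_comp (alg_mulr_linear _) lF0.
  case=> a b; move: y'; apply: (@malg_linear_ext R _ (alg_module C)
    (fun z => F0 (free_mul << (a, b) >> z)) (fun z => (F0 << (a, b) >> : C) * F0 z)).
  + exact: linear_comp lF0 (free_mul_linearr _).
  + exact: linear_comp (alg_mull_linear _) lF0.
  case=> a' b'; rewrite free_mulUU !F0U !rmorphM /= -!mulrA; congr (_ * _).
  by rewrite !mulrA (fg a').
- by rewrite F_tensor alghom_algmap rmorph1 mulr1.
by exists G => a b; rewrite GF F_tensor.
Qed.

(** The two factors generate, because a (x) b = (a (x) 1) (1 (x) b). *)
Lemma tensor_ext (F G : alghom (tensor_product A B) C) :
  (forall a, F (tensor a 1) = G (tensor a 1)) ->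
  (forall b, F (tensor 1 b) = G (tensor 1 b)) -> F =1 G.
Proof.
move=> FGl FGr x; have [g ->] := tensor_piP x.
elim/malg_ind: g => [|c [a b] g IH]; first by rewrite raddf0 !rmorph0.
rewrite raddfD /= !rmorphD IH; congr (_ + _).
have -> : tensor_pi (c *: << (a, b) >>) = tensor (algmap c * a) b.
  by apply/esym/tensor_eqP/mem_lin_span/Bilinear_relZl.
have -> : tensor (algmap c * a) b = tensor (algmap c * a) 1 * tensor 1 b.
  by rewrite tensorM mulr1 mul1r.
by rewrite !rmorphM FGl FGr.
Qed.

End TensorProduct.

(** * Words in anticommuting elements *)

Section SignedWords.
Variable b : bool.

(* [(s, [:: c_0; ...; c_n])] stands for (-1)^s e_0^c_0 ... e_n^c_n, where the
   e_i anticommute and square to (-1)^b. *)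
Definition sword := (bool * seq bool)%type.

Definition odd_mask (m : seq bool) := odd (count id m).

(* Moving e_k^d to the left across the remaining factors of [m] costs a sign for
   each of them; then e_k^c e_k^d = (-1)^(b c d) e_k^(c xor d). *)
Fixpoint mask_mul (m m' : seq bool) : sword :=
  match m, m' with
  | c :: m, d :: m' => let: (s, r) := mask_mul m m' in
    (s (+) (d && odd_mask m) (+) [&& b, c & d], (c (+) d) :: r)
  | _, _ => (false, [::])
  end.

Definition sword_mul (u v : sword) : sword :=
  let: (s, r) := mask_mul u.2 v.2 in (u.1 (+) v.1 (+) s, r).

Lemma size_mask_mul m m' : size m = size m' -> size (mask_mul m m').2 = size m.
Proof.
elim: m m' => [|c m IH] [|d m'] //= [/IH].
by case: (mask_mul m m') => s r /= ->.
Qed.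

Lemma size_sword_mul n u v :
  size u.2 == n -> size v.2 == n -> size (sword_mul u v).2 == n.
Proof.
move=> /eqP un /eqP vn; have := @size_mask_mul u.2 v.2.
by rewrite /sword_mul un vn; case: mask_mul => s r /= ->.
Qed.

Definition sword_opp (u : sword) : sword := (~~ u.1, u.2).

Variable A : pzRingType.

Definition clifford_family n (e : nat -> A) := forall i j, (i < n)%N -> (j < n)%N ->
  e i * e j = if i == j then (-1) ^+ b else - (e j * e i).

(** The offset [k] is the index of the first letter of the mask, as recursion on the mask
    requires. *)
Fixpoint mask_eval (e : nat -> A) k m :=
  if m is c :: m' then e k ^+ (c : bool) * mask_eval e k.+1 m' else 1.

Definition sword_eval e (u : sword) := (-1) ^+ u.1 * mask_eval e 0 u.2.

Lemma sword_eval_opp e u : sword_eval e (sword_opp u) = - sword_eval e u.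
Proof. by rewrite /sword_eval !mulr_sign /=; case: u.1; rewrite ?opprK. Qed.

(** Each letter present in [m] contributes one sign as [x] passes it. *)
Lemma mask_eval_comm e k m x :
  (forall i, (k <= i < k + size m)%N -> e i * x = - (x * e i)) ->
  mask_eval e k m * x = (-1) ^+ odd_mask m * (x * mask_eval e k m).
Proof.
elim: m k => [|c m IH] k /= ex; first by rewrite !mul1r mulr1.
rewrite -mulrA IH => [|i /andP[ki im]]; last first.
  by apply: ex; rewrite (ltnW ki) addnS.
rewrite /odd_mask /= oddD !mulr_sign.
have ek : e k * x = - (x * e k) by rewrite ex // leqnn addnS ltnS leq_addr.
case: c; rewrite /= ?expr1 ?expr0 ?mul1r //.
by case: odd; rewrite ?mulrN !mulrA ek ?mulNr ?opprK.
Qed.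

Lemma mask_evalM n e k m m' : clifford_family n e ->
  size m = size m' -> (k + size m <= n)%N ->
  mask_eval e k m * mask_eval e k m' =
  (-1) ^+ (mask_mul m m').1 * mask_eval e k (mask_mul m m').2.
Proof.
move=> eP; elim: m m' k => [|c m IH] [|d m'] //= k.
move=> [mm']; rewrite addnS => kn.
have kltn : (k < n)%N by apply: leq_trans kn; rewrite ltnS leq_addr.
have := IH m' k.+1 mm' kn; case: (mask_mul m m') => s r /= E.
have ek : mask_eval e k.+1 m * e k = (-1) ^+ odd_mask m * (e k * mask_eval e k.+1 m).
  apply: mask_eval_comm => i /andP[ki im].
  by rewrite eP ?(leq_trans im kn) // eq_sym (ltn_eqF ki).
have sq : e k * e k = (-1) ^+ b by rewrite eP // eqxx.
have Ed : mask_eval e k.+1 m * e k ^+ d =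
    (-1) ^+ (d && odd_mask m) * (e k ^+ d * mask_eval e k.+1 m).
  by case: d => //=; rewrite !mul1r mulr1.
have Ecd : e k ^+ c * e k ^+ d = (-1) ^+ [&& b, c & d] * e k ^+ (c (+) d).
  case: (c); case: (d) => /=; rewrite ?andbF ?expr0 ?expr1 ?mulr1 ?mul1r //.
  by rewrite andbT.
rewrite mulrA -(mulrA (_ ^+ c)) Ed [RHS]mulr_sign.
have -> : e k ^+ c * ((-1) ^+ (d && odd_mask m) * (e k ^+ d * mask_eval e k.+1 m))
    * mask_eval e k.+1 m' = (-1) ^+ (d && odd_mask m) *
    ((e k ^+ c * e k ^+ d) * (mask_eval e k.+1 m * mask_eval e k.+1 m')).
  by rewrite !mulr_sign; case: ifP => _; rewrite ?mulNr ?mulrN ?mulNr !mulrA.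
rewrite E Ecd !mulr_sign.
case: [&& b, c & d]; case: s {E}; case: (d && odd_mask m) => /=.
all: by rewrite ?mulNr ?mulrN ?opprK ?mulNr ?opprK.
Qed.

(** This transfers computed identities between signed words to every algebra that contains such a
    family. *)
Lemma sword_evalM n e u v : clifford_family n e ->
  size u.2 = size v.2 -> (size u.2 <= n)%N ->
  sword_eval e (sword_mul u v) = sword_eval e u * sword_eval e v.
Proof.
move=> eP uv un; have := @mask_evalM n e 0 u.2 v.2 eP uv un.
rewrite /sword_mul /sword_eval; case: mask_mul => s r /= E.
rewrite !signr_addb !mulr_sign; case: u.1; case: v.1 => /=.
all: by rewrite ?mulNr ?mulrN ?opprK ?mulN1r ?mul1r ?opprK E mulr_sign ?mulNr ?opprK;
  case: s {E}; rewrite ?opprK.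
Qed.

End SignedWords.

Lemma rmorph_mask_eval (A B : pzRingType) (g : {rmorphism A -> B}) e k m :
  g (mask_eval e k m) = mask_eval (g \o e) k m.
Proof.
elim: m k => [|d m IH] k /=; first exact: rmorph1.
by rewrite rmorphM rmorphXn IH.
Qed.

(** * The Hamming code and spinor matrices *)

Section Hamming.
Variable b : bool.
Local Notation mul := (sword_mul b).
Local Open Scope nat_scope.

Definition sword1 : sword := (false, nseq 8 false).
Definition sword_gen k : sword := (false, mkseq (eq_op k) 8).
(** Binary digits: an index below 16 encodes a subset of {0, 1, 2, 3}. *)
Definition bits i := [seq k <- iota 0 4 | odd (i %/ 2 ^ k)].

(* Rows of a systematic generator matrix [I | J - I] of the extended Hamming
   [8, 4] code. All codewords have even weight and meet evenly, so the words
   commute; the weights are divisible by 4, so they square to 1 for both signs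
   of the form. *)
Definition hamming_gen k : sword :=
  (false, mkseq (fun j => (j == k) || (4 <= j) && (j != 4 + k)) 8).
Definition hamming i := foldr mul sword1 (map hamming_gen (bits i)).
Definition coset_rep i := foldr mul sword1 (map sword_gen (bits i)).
(** X_i squares to a sign, so its inverse is X_i multiplied by that sign. *)
Definition coset_rep_inv i : sword :=
  ((mul (coset_rep i) (coset_rep i)).1, (coset_rep i).2).

(* For [k >= 4] the coset of e_k modulo the code is represented by the product
   of the e_j with [j < 4] and [j != k - 4]; the codeword of index
   [hamming_shift k] realizes the reduction. *)
Definition hamming_shift k := if k < 4 then 0 else 15 - 2 ^ (k - 4).
Definition spin k i : sword :=
  mul (sword_gen k) (mul (coset_rep i) (hamming (hamming_shift k))).
(* e_k X_i P = (-1)^(spin_sign k i) X_(spin_index k i) P, where X_i is the word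
   [coset_rep i] and P is the projector fixed by all codewords. *)
Definition spin_index k i :=
  sumn [seq 2 ^ j | j <- iota 0 4 & nth false (spin k i).2 j].
Definition spin_sign k i := (spin k i).1.

(** In order: lengths of the words; translations permute the signed codewords; inverses of the X_i;
    a codeword separating X_i from X_j, for orthogonality of the spinors; cancellation in pairs of
    the conjugated codewords, for completeness; the action of e_k on the spinors; the Clifford
    relations for that action. *)
Definition hamming_checks : bool :=
  let I := iota 0 16 in
  let K := iota 0 8 in
  [&& all (fun i => (size (hamming i).2 == 8) && (size (coset_rep i).2 == 8)) I,
      all (fun t => perm_eq [seq mul (hamming t) (hamming s) | s <- I] (map hamming I)
        && perm_eq [seq mul (hamming s) (hamming t) | s <- I] (map hamming I)) I,
      all (fun i => mul (coset_rep_inv i) (coset_rep i) == sword1) I,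
      all (fun i => all (fun j => (i == j) ||
        has (fun t => let w := mul (coset_rep_inv j) (coset_rep i) in
          mul (hamming t) w == sword_opp (mul w (hamming t))) I) I) I,
      (let conj := [seq mul (mul (coset_rep i) (hamming t)) (coset_rep_inv i) | i <- I, t <- I] in
       let pos := [seq u <- conj | ~~ u.1 && (u != sword1)] in
       perm_eq conj (nseq 16 sword1 ++ pos ++ map sword_opp pos)),
      all (fun k => all (fun i => (spin_index k i < 16) &&
        (spin k i == (spin_sign k i, (coset_rep (spin_index k i)).2)) && ~~ (coset_rep i).1) I) K &
      all (fun k => all (fun l => all (fun i =>
        (spin_index k (spin_index l i) == (if k == l then i else spin_index l (spin_index k i))) &&
        (spin_sign k (spin_index l i) (+) spin_sign l i ==
           if k == l then b else ~~ (spin_sign l (spin_index k i) (+) spin_sign k i))) I) K) K].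

End Hamming.

Lemma sword_eval_gen (A : pzRingType) (e : nat -> A) k :
  (k < 8)%N -> sword_eval e (sword_gen k) = e k.
Proof.
by do 8?[case: k => [|k]] => // _; rewrite /sword_eval /= ?mul1r ?mulr1.
Qed.

Lemma hamming_checked b : hamming_checks b.
Proof. by case: b; vm_compute. Qed.

(** * The volume element of rank 8 *)

Definition volume : sword := (false, nseq 8 true).

Section Volume.
Variables (b : bool) (A : pzRingType) (e : nat -> A).
Hypothesis eP : clifford_family b 8 e.

(** Reversing eight letters takes 28 transpositions, and the eight squares contribute (-1)^(8b);
    both signs are positive. *)
Lemma volume_sq : sword_eval e volume * sword_eval e volume = 1.
Proof.
rewrite -(sword_evalM eP) //.
have -> : sword_mul b volume volume = sword1 by case: (b); vm_compute.
by rewrite /sword_eval /= !mul1r.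
Qed.

(** The letter e_k commutes with itself and anticommutes with the seven others. *)
Lemma volume_anticomm k : (k < 8)%N ->
  sword_eval e volume * e k = - (e k * sword_eval e volume).
Proof.
move=> k8; rewrite -(sword_eval_gen e k8) -!(sword_evalM eP) ?size_mkseq //.
rewrite -sword_eval_opp; congr sword_eval; move: k k8.
by do 8?[case=> [|]] => // _; case: (b); vm_compute.
Qed.

End Volume.

(** * Morphisms from a matrix algebra given by matrix units *)

Section MatrixUnits.
Variables (R : comNzRingType) (A : pzAlgType R) (n : nat).
Variables (P : A) (a a' : 'I_n -> A).
Hypothesis a'a : forall i j, a' i * a j = if i == j then P else 0.
Hypothesis aP : forall i, a i * P = a i.
Hypothesis aa' : \sum_i a i * a' i = 1.

Let combine (M : 'M[R]_n) : A := \sum_i \sum_j algmap (M i j) * (a i * a' j).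

Let combine_row M i : a' i * combine M = \sum_j algmap (M i j) * (P * a' j).
Proof.
rewrite mulr_sumr (bigD1 i) //= [X in _ + X]big1 ?addr0 => [|k ki].
  rewrite mulr_sumr; apply: eq_bigr => j _.
  by rewrite !mulrA -(algmap_comm _ (a' i)) -!mulrA (mulrA (a' i)) a'a eqxx.
rewrite mulr_sumr big1 // => j _.
rewrite !mulrA -(algmap_comm _ (a' i)) -!mulrA (mulrA (a' i)) a'a eq_sym.
by rewrite (negbTE ki) mul0r mulr0.
Qed.

(** The products a_i a'_j are matrix units: (a_i a'_j) (a_k a'_l) is a_i P a'_l = a_i a'_l if j = k
    and 0 otherwise, and the diagonal ones sum to 1. *)
Lemma matrix_units : exists g : alghom 'M[R]_n A,
  forall M, g M = \sum_i \sum_j algmap (M i j) * (a i * a' j).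
Proof.
have combine_scalar c : combine c%:M = algmap c.
  rewrite -[RHS]mulr1 -aa' mulr_sumr; apply: eq_bigr => i _.
  rewrite (bigD1 i) //= big1 => [|j ji]; first by rewrite !mxE eqxx addr0.
  by rewrite !mxE eq_sym (negbTE ji) rmorph0 mul0r.
apply: alghomP => [M N||].
- rewrite -sumrB; apply: eq_bigr => i _; rewrite -sumrB; apply: eq_bigr => j _.
  by rewrite !mxE rmorphB mulrBl.
- split=> [|M N]; first exact: etrans (combine_scalar 1) (rmorph1 _).
  rewrite -/(combine M) -/(combine N) {1}/combine mulr_suml; apply: eq_bigr => i _.
  rewrite mulr_suml.
  transitivity (\sum_j \sum_k algmap (M i j * N j k) * (a i * a' k)).
    rewrite exchange_big; apply: eq_bigr => k _.
    by rewrite -mulr_suml mxE rmorph_sum.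
  apply: eq_bigr => j _; rewrite -!mulrA combine_row !mulr_sumr.
  apply: eq_bigr => k _; rewrite rmorphM -!mulrA; congr (_ * _).
  by rewrite (mulrA (a i)) -(algmap_comm _ (a i)) -mulrA (mulrA (a i)) aP.
- exact: combine_scalar.
Qed.

(** The entries can be recovered from the image, since a'_i g(M) a_j = M_ij P. *)
Lemma matrix_units_inj (g : alghom 'M[R]_n A) :
  (forall M, g M = \sum_i \sum_j algmap (M i j) * (a i * a' j)) ->
  (forall c, algmap c * P = 0 -> c = 0) -> injective g.
Proof.
move=> gE P0; apply: raddf_inj => M gM0; apply/matrixP => i j; rewrite mxE.
have E : a' i * a i = P by rewrite a'a eqxx.
have PP : P * P = P by rewrite -[X in X * _]E -mulrA aP.
have {}gM0 : g M = 0 := gM0.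
apply: P0; rewrite -[RHS](mul0r (a j)) -(mulr0 (a' i)) -gM0 gE combine_row.
rewrite mulr_suml (bigD1 j) //= big1 ?addr0 => [|k kj].
  by rewrite -!mulrA a'a eqxx PP.
by rewrite -!mulrA a'a (negbTE kj) !mulr0.
Qed.

End MatrixUnits.

Arguments spin_index : simpl never.
Arguments spin_sign : simpl never.
Arguments hamming : simpl never.
Arguments coset_rep : simpl never.
Arguments coset_rep_inv : simpl never.
Arguments sword_mul : simpl never.

(** * Consequences of the computed checks *)

Section HammingFacts.
Variable b : bool.
Local Notation mul := (sword_mul b).
Local Notation checks := (hamming_checked b).

Let mem_iota0 (n k : nat) : (k < n)%N -> k \in iota 0 n.
Proof. by move=> kn; rewrite mem_iota. Qed.

Lemma size_hamming i : (i < 16)%N -> size (hamming b i).2 == 8.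
Proof. by case/and4P: checks => /allP h _ _ _ /mem_iota0/h/andP[]. Qed.

Lemma size_coset_rep i : (i < 16)%N -> size (coset_rep b i).2 == 8.
Proof. by case/and4P: checks => /allP h _ _ _ /mem_iota0/h/andP[]. Qed.

Lemma hammingMl t : (t < 16)%N ->
  perm_eq [seq mul (hamming b t) (hamming b s) | s <- iota 0 16]
          (map (hamming b) (iota 0 16)).
Proof. by case/and4P: checks => _ /allP h _ _ /mem_iota0/h/andP[]. Qed.

Lemma hammingMr t : (t < 16)%N ->
  perm_eq [seq mul (hamming b s) (hamming b t) | s <- iota 0 16]
          (map (hamming b) (iota 0 16)).
Proof. by case/and4P: checks => _ /allP h _ _ /mem_iota0/h/andP[]. Qed.

Lemma coset_rep_invM i : (i < 16)%N ->
  mul (coset_rep_inv b i) (coset_rep b i) = sword1.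
Proof. by case/and4P: checks => _ _ /allP h _ /mem_iota0/h/eqP. Qed.

Lemma hamming_anticomm i j : (i < 16)%N -> (j < 16)%N -> i != j ->
  exists2 t, (t < 16)%N & let w := mul (coset_rep_inv b j) (coset_rep b i) in
    mul (hamming b t) w = sword_opp (mul w (hamming b t)).
Proof.
case/and5P: checks => _ _ _ /allP h _ /mem_iota0/h/allP{}h /mem_iota0/h /predU1P[->|].
  by rewrite eqxx.
by case/hasP => t; rewrite mem_iota => tlt /eqP; exists t.
Qed.

Lemma hamming_conj_sum : exists pos,
  perm_eq [seq mul (mul (coset_rep b i) (hamming b t)) (coset_rep_inv b i) |
             i <- iota 0 16, t <- iota 0 16]
          (nseq 16 sword1 ++ pos ++ map sword_opp pos).
Proof. by case/and5P: checks => _ _ _ _ /andP[h _]; eexists; exact: h. Qed.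

Lemma spinP k i : (k < 8)%N -> (i < 16)%N ->
  (spin_index b k i < 16)%N /\
  spin b k i = (spin_sign b k i, (coset_rep b (spin_index b k i)).2).
Proof.
case/and5P: checks => _ _ _ _ /and3P[_ /allP h _] /mem_iota0/h/allP{}h /mem_iota0/h.
by rewrite -andbA => /and3P[-> /eqP].
Qed.

Lemma coset_rep_sign i : (i < 16)%N -> (coset_rep b i).1 = false.
Proof.
case/and5P: checks => _ _ _ _ /and3P[_ /allP/(_ 0 isT)/allP h _] /mem_iota0/h.
by case/andP => _ /negbTE.
Qed.

Lemma spin_relation k l i : (k < 8)%N -> (l < 8)%N -> (i < 16)%N ->
  spin_index b k (spin_index b l i) =
    (if k == l then i else spin_index b l (spin_index b k i)) /\
  spin_sign b k (spin_index b l i) (+) spin_sign b l i =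
    (if k == l then b else ~~ (spin_sign b l (spin_index b k i) (+) spin_sign b k i)).
Proof.
case/and5P: checks => _ _ _ _ /and3P[_ _ /allP h] /mem_iota0/h/allP{}h /mem_iota0/h/allP{}h.
by case/mem_iota0/h/andP => /eqP -> /eqP ->.
Qed.

End HammingFacts.

(** * Signed permutation matrices *)

Section SignedPermutationMatrices.
Variables (R : comNzRingType) (n : nat).

(** Acting on columns, it sends the j-th basis vector to (-1)^(s j) times the one of index [f j], or
    to 0 if [f j] is out of range. *)
Definition signed_mx (f : nat -> nat) (s : nat -> bool) : 'M[R]_n :=
  \matrix_(i, j) if val i == f j then (-1) ^+ s j else 0.

Lemma signed_mxM f g s t : (forall j, (j < n)%N -> (g j < n)%N) ->
  signed_mx f s *m signed_mx g t =
  signed_mx (f \o g) (fun j => s (g j) (+) t j).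
Proof.
move=> gn; apply/matrixP => i j; rewrite mxE (bigD1 (Ordinal (gn j (ltn_ord j)))) //=.
rewrite big1 => [|m mj]; last first.
  rewrite !mxE; case: (altP (val m =P g j)) => [mE|_]; last by rewrite mulr0.
  by rewrite -val_eqE /= mE eqxx in mj.
rewrite !mxE addr0 /= eqxx signr_addb.
by case: ifP => // _; rewrite mul0r.
Qed.

Lemma signed_mx_scalar f s b : (forall j, (j < n)%N -> f j = j /\ s j = b) ->
  signed_mx f s = ((-1) ^+ b)%:M.
Proof.
move=> fs; apply/matrixP => i j; rewrite !mxE.
by have [-> ->] := fs j (ltn_ord j); rewrite val_eqE; case: (i == j).
Qed.

Lemma signed_mx_opp f g s t :
  (forall j, (j < n)%N -> f j = g j /\ s j = ~~ t j) ->
  signed_mx f s = - signed_mx g t.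
Proof.
move=> fs; apply/matrixP => i j; rewrite !mxE.
have [-> ->] := fs j (ltn_ord j); case: ifP => _; rewrite ?oppr0 //.
by case: (t j); rewrite ?opprK.
Qed.

End SignedPermutationMatrices.

(** Matrix of left multiplication by e_k on the spinors X_i P. *)
Definition spin_mx (R : comNzRingType) b k : 'M[R]_16 :=
  signed_mx R 16 (spin_index b k) (spin_sign b k).

Lemma spin_mx_family (R : comNzRingType) b : clifford_family b 8 (spin_mx R b).
Proof.
move=> k l k8 l8; rewrite -[_ * _]/(_ *m _) -[spin_mx R b l * _]/(_ *m _).
have lt16 m j : (m < 8)%N -> (j < 16)%N -> (spin_index b m j < 16)%N.
  by move=> m8 /(spinP b m8)[].
rewrite !signed_mxM => [|j|j]; [|exact: lt16|exact: lt16].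
case: eqP => [<-|/eqP kl].
  have -> : (-1) ^+ b = ((-1) ^+ b)%:M :> 'M[R]_16.
    by rewrite rmorphXn rmorphN1.
  apply: signed_mx_scalar => j j16.
  rewrite [X in X = _ /\ _]/comp.
  by have := spin_relation b k8 k8 j16; rewrite eqxx.
apply: signed_mx_opp => j j16.
rewrite /comp.
by have := spin_relation b k8 l8 j16; rewrite (negbTE kl).
Qed.

(** * Spinors and matrix units from eight anticommuting elements *)

Section Spinors.
Variables (R : comUnitRingType) (A : pzAlgType R) (b : bool) (e : nat -> A).
Hypothesis R2 : (2%:R : R) \is a GRing.unit.
Hypothesis eP : clifford_family b 8 e.
Local Notation ev := (sword_eval e).
Local Notation S t := (ev (hamming b t)).
Local Notation X i := (ev (coset_rep b i)).
Local Notation X' i := (ev (coset_rep_inv b i)).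

Let evM u v : size u.2 == 8 -> size v.2 == 8 ->
  ev (sword_mul b u v) = ev u * ev v.
Proof. by move=> /eqP u8 /eqP v8; rewrite (sword_evalM eP) ?u8 ?v8. Qed.

Let ev1 : ev sword1 = 1.
Proof. by rewrite /sword_eval /= !mul1r. Qed.

Let size_rep_inv i : (i < 16)%N -> size (coset_rep_inv b i).2 == 8.
Proof. exact: size_coset_rep. Qed.

(** Expanding the product of the projectors (1 + S) / 2 over the four generators of the code gives
    this average of all codewords. *)
Definition spinor_proj : A := algmap (16%:R^-1) * \sum_(t <- iota 0 16) S t.
Local Notation P := spinor_proj.

Let R16 : (16%:R : R) \is a GRing.unit.
Proof. by rewrite (natrX _ 2 4) unitrX. Qed.

Let iota16 t : t \in iota 0 16 -> (t < 16)%N.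
Proof. by rewrite mem_iota. Qed.

(** Translation by a codeword permutes the terms of the average. *)
Lemma hamming_proj t : (t < 16)%N -> S t * P = P.
Proof.
move=> t16; rewrite /P mulrA -(algmap_comm _ (S t)) -mulrA; congr (_ * _).
rewrite -[RHS](big_map (hamming b) xpredT ev).
rewrite -[RHS](perm_big _ (hammingMl b t16)) [RHS]big_map mulr_sumr.
apply: eq_big_seq => s /iota16 s16.
by rewrite evM ?size_hamming.
Qed.

Lemma proj_hamming t : (t < 16)%N -> P * S t = P.
Proof.
move=> t16; rewrite /P -mulrA; congr (_ * _).
rewrite -[RHS](big_map (hamming b) xpredT ev).
rewrite -[RHS](perm_big _ (hammingMr b t16)) [RHS]big_map mulr_suml.
apply: eq_big_seq => s /iota16 s16.
by rewrite evM ?size_hamming.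
Qed.

Lemma spinor_proj_idem : P * P = P.
Proof.
rewrite {1}/P -mulrA mulr_suml.
rewrite (eq_big_seq (fun=> P)) => [|t /iota16 t16]; last exact: hamming_proj.
rewrite big_const_seq count_predT size_iota iter_addr_0 -[P *+ _]mulr_natl mulrA.
by rewrite -(rmorph_nat algmap) -rmorphM mulVr // rmorph1 mul1r.
Qed.

Lemma eq_opp_eq0 (x : A) : x = - x -> x = 0.
Proof.
move=> xN; have x2 : x *+ 2 = 0 by rewrite mulr2n {1}xN addNr.
have -> : x = algmap (2%:R^-1 * 2%:R) * x by rewrite mulVr // rmorph1 mul1r.
by rewrite rmorphM rmorph_nat -mulrA mulr_natl x2 mulr0.
Qed.

(** For distinct indices some codeword S anticommutes with w = X_i^-1 X_j. As P absorbs S on both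
    sides, P w P = P S w P = - P w S P = - P w P, and 2 is invertible. *)
Lemma spinor_orthogonal i j : (i < 16)%N -> (j < 16)%N ->
  P * X' i * (X j * P) = if i == j then P else 0.
Proof.
move=> i16 j16; rewrite mulrA -(mulrA P).
rewrite -evM ?size_rep_inv ?size_coset_rep //.
case: (altP (i =P j)) => [<-|ij].
  by rewrite coset_rep_invM // ev1 mulr1 spinor_proj_idem.
rewrite eq_sym in ij; have [t t16 /=] := hamming_anticomm b j16 i16 ij.
set w := sword_mul b (coset_rep_inv b i) _ => St.
have w8 : size w.2 == 8.
  by apply: size_sword_mul; [apply: size_rep_inv | apply: size_coset_rep].
apply: eq_opp_eq0; rewrite -{1}(proj_hamming t16) -(mulrA P) -evM ?size_hamming //.
rewrite St sword_eval_opp evM ?size_hamming // mulrN mulNr.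
by rewrite (mulrA P (ev w)) -(mulrA _ (S t)) hamming_proj.
Qed.

(* Conjugation by X_i changes the sign of a codeword by a character of i which is
   trivial only for the empty word, so that all other terms cancel in pairs. *)
Lemma spinor_complete :
  \sum_(i < 16) (X i * P) * (P * X' i) = 1.
Proof.
transitivity (\sum_(i <- iota 0 16) (X i * P) * (P * X' i)).
  by rewrite -[iota 0 16]/(index_iota 0 16) big_mkord.
transitivity (algmap (16%:R^-1) *
    \sum_(u <- [seq sword_mul b (sword_mul b (coset_rep b i) (hamming b t))
                  (coset_rep_inv b i) | i <- iota 0 16, t <- iota 0 16]) ev u).
  rewrite big_allpairs_dep mulr_sumr; apply: eq_big_seq => i /iota16 i16 /=.
  rewrite mulrA -(mulrA (X i)) spinor_proj_idem /P.
  rewrite (mulrA (X i)) -(algmap_comm _ (X i)) -2!(mulrA (algmap _)).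
  congr (_ * _).
  rewrite mulr_sumr mulr_suml; apply: eq_big_seq => t /iota16 t16.
  by rewrite !evM ?size_sword_mul ?size_rep_inv ?size_coset_rep ?size_hamming.
have [pos posP] := hamming_conj_sum b; rewrite (perm_big _ posP).
have cat_sum r s :
    \sum_(u <- r ++ s) ev u = \sum_(u <- r) ev u + \sum_(u <- s) ev u.
  exact: big_cat.
have pos0 : \sum_(u <- pos ++ map sword_opp pos) ev u = 0.
  rewrite cat_sum big_map -big_split /= big1 // => u _.
  by rewrite sword_eval_opp subrr.
rewrite cat_sum pos0 addr0 big_nseq ev1 iter_addr_0 -(rmorph_nat algmap) -rmorphM.
by rewrite mulVr // rmorph1.
Qed.

(** P absorbs the codeword of index [hamming_shift k]; inserting it after X_i turns e_k X_i into a
    signed coset representative. *)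
Lemma gen_spinor k i : (k < 8)%N -> (i < 16)%N ->
  e k * (X i * P) = (-1) ^+ spin_sign b k i * (X (spin_index b k i) * P).
Proof.
move=> k8 i16; have [j16 spinE] := spinP b k8 i16.
have t16 : (hamming_shift k < 16)%N.
  by rewrite /hamming_shift; case: ifP => // _; apply: leq_ltn_trans (leq_subr _ _) _.
rewrite -{1}(hamming_proj t16) -(sword_eval_gen e k8) 2!(mulrA _ _ P).
rewrite -!evM ?size_sword_mul ?size_mkseq ?size_coset_rep ?size_hamming //.
rewrite -[sword_mul _ _ _]/(spin b k i) spinE [RHS]mulrA; congr (_ * P).
by rewrite /sword_eval coset_rep_sign // expr0 mul1r.
Qed.

(** By completeness e_k is the sum of the e_k X_j P X_j^-1, and [gen_spinor] makes each summand a
    signed matrix unit. *)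
Lemma spinor_matrix_units : exists2 g : alghom 'M[R]_16 A,
  (forall k, (k < 8)%N -> g (spin_mx R b k) = e k) &
  ((forall c : R, algmap c = 0 :> A -> c = 0) -> injective g).
Proof.
have [|||g gE] := @matrix_units R A 16 P (fun i => X i * P) (fun i => P * X' i).
- by move=> i j; rewrite spinor_orthogonal.
- by move=> i; rewrite -mulrA spinor_proj_idem.
- exact: spinor_complete.
exists g => [k k8|A0].
  rewrite gE -[RHS]mulr1 -spinor_complete mulr_sumr exchange_big.
  apply: eq_bigr => j _ /=; rewrite [RHS]mulrA gen_spinor //.
  have [lt16 _] := spinP b k8 (ltn_ord j).
  rewrite (bigD1 (Ordinal lt16)) //= big1 ?addr0 => [|m mj]; last first.
    by rewrite mxE -val_eqE in mj *; rewrite (negbTE mj) rmorph0 mul0r.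
  by rewrite mxE eqxx rmorph_sign -[RHS]mulrA.
apply: (matrix_units_inj _ _ gE) => [||c cP].
- by move=> i j; rewrite spinor_orthogonal.
- by move=> i; rewrite -mulrA spinor_proj_idem.
(* A scalar that kills P kills every X_i P X_i^-1, hence also their sum 1. *)
apply: A0; rewrite -[algmap c]mulr1 -spinor_complete mulr_sumr big1 // => i _.
rewrite mulrA (mulrA (algmap c)) (algmap_comm c (X i)).
by rewrite -(mulrA (X i)) cP mulr0 mul0r.
Qed.

End Spinors.

(** * Clifford algebras of definite forms of rank 8 *)

Section CliffordInjectionSum.
Variables (R : comNzRingType) (V : lmodType R) (Phi : V -> R).

Lemma clifford_inj0 : clifford_inj Phi 0 = 0.
Proof. by rewrite -(scale0r 0) clifford_injZ rmorph0 mul0r. Qed.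

Lemma clifford_inj_sum (I : Type) (r : seq I) (F : I -> V) :
  clifford_inj Phi (\sum_(i <- r) F i) = \sum_(i <- r) clifford_inj Phi (F i).
Proof. exact: (big_morph _ (clifford_injD Phi) clifford_inj0). Qed.

End CliffordInjectionSum.

(** Each term anticommutes with the sum of the later ones, so the cross terms cancel. *)
Lemma sum_anticomm_sq (A : pzRingType) (I : eqType) (r : seq I) (y : I -> A) :
  uniq r -> (forall i j, i != j -> y i * y j = - (y j * y i)) ->
  (\sum_(i <- r) y i) * (\sum_(i <- r) y i) = \sum_(i <- r) y i * y i.
Proof.
move=> + yN; elim: r => [|i r IH]; first by rewrite !big_nil mulr0.
rewrite cons_uniq => /andP[ir /IH{}IH]; rewrite !big_cons mulrDl !mulrDr IH.
rewrite addrA -(addrA (y i * y i)).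
suff -> : y i * \sum_(j <- r) y j = - ((\sum_(j <- r) y j) * y i).
  by rewrite addNr addr0.
rewrite mulr_sumr mulr_suml -sumrN; apply: eq_big_seq => j jr.
by apply: yN; apply: contraNneq ir => ->.
Qed.

(** * Presentation by eight anticommuting generators *)

Section DefiniteForm.
Variables (R : comNzRingType) (b : bool) (Psi : 'rV[R]_8 -> R).
Hypothesis PsiE : forall x, Psi x = (-1) ^+ b * \sum_k x 0 k ^+ 2.

Definition clifford_gen k : clifford Psi :=
  clifford_inj Psi (\row_j (val j == k)%:R).

Lemma clifford_inj_gen x :
  clifford_inj Psi x = \sum_(k < 8) algmap (x 0 k) * clifford_gen k.
Proof.
have {1}-> : x = \sum_(k < 8) x 0 k *: (\row_j (val j == k)%:R).
  apply/rowP => j; rewrite summxE (bigD1 j) //= big1 ?addr0 => [|k kj].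
    by rewrite !mxE eqxx mulr1.
  by rewrite !mxE val_eqE eq_sym (negbTE kj) mulr0.
by rewrite clifford_inj_sum; apply: eq_bigr => k _; rewrite clifford_injZ.
Qed.

Lemma clifford_gen_family : clifford_family b 8 clifford_gen.
Proof.
move=> k l k8 l8; case: eqP => [<-|/eqP kl].
  rewrite /clifford_gen clifford_sq PsiE (bigD1 (Ordinal k8)) //= big1.
    by rewrite mxE eqxx expr1n addr0 mulr1 rmorph_sign.
  by move=> j; rewrite -val_eqE mxE => /negbTE ->; rewrite expr0n.
apply: clifford_inj_anticomm; rewrite !PsiE -mulrDr -big_split; congr (_ * _).
apply: eq_bigr => j _; rewrite !mxE /=.
case: (altP (val j =P k)) => [->|_]; last first.
  by rewrite mulr0n !add0r expr0n add0r.
by rewrite (negbTE kl) mulr0n addr0 expr0n addr0.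
Qed.

(** The linear extension of [e] squares to [Psi], because the cross terms cancel and each e_k
    squares to (-1)^b. *)
Lemma definite_clifford_lift (A : pzAlgType R) (e : nat -> A) :
  clifford_family b 8 e ->
  exists F : alghom (clifford Psi) A, forall k, (k < 8)%N -> F (clifford_gen k) = e k.
Proof.
move=> eP; pose f (x : 'rV[R]_8) : alg_module A :=
  (\sum_(k < 8) algmap (x 0 k) * e k : A).
have lf : linear f.
  move=> c x y; rewrite /f scaler_sumr -big_split; apply: eq_bigr => k _.
  by rewrite !mxE rmorphD rmorphM mulrDl alg_moduleZ mulrA.
have [x|F FE] := clifford_lift (Phi := Psi) lf.
  have scaleM (c d : R) (u v : A) :
      algmap c * u * (algmap d * v) = algmap (c * d) * (u * v).
    by rewrite rmorphM -!mulrA; congr (_ * _); rewrite !mulrA (algmap_comm d).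
  rewrite /f sum_anticomm_sq ?index_enum_uniq // => [|i j ij].
    rewrite PsiE rmorphM rmorph_sign rmorph_sum mulr_sumr; apply: eq_bigr => k _.
    by rewrite scaleM eP // eqxx expr2 mulr_sign commr_sign mulr_sign.
  by rewrite !scaleM eP // val_eqE (negbTE ij) mulrN mulrC.
exists F => k k8; rewrite /clifford_gen FE /f (bigD1 (Ordinal k8)) //= big1.
  by rewrite mxE eqxx rmorph1 mul1r addr0.
by move=> j; rewrite -val_eqE mxE => /negbTE ->; rewrite rmorph0 mul0r.
Qed.

Lemma definite_clifford_ext (A : pzAlgType R) (F G : alghom (clifford Psi) A) :
  (forall k, (k < 8)%N -> F (clifford_gen k) = G (clifford_gen k)) -> F =1 G.
Proof.
move=> FG; apply: clifford_ext => v; rewrite clifford_inj_gen !rmorph_sum.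
by apply: eq_bigr => k _; rewrite !rmorphM !alghom_algmap FG.
Qed.

End DefiniteForm.

(** The composite of [F] and then [g] fixes the generators, hence is the identity; injectivity of
    [g] makes it a two-sided inverse. *)
Lemma definite_clifford_matrix (R : comUnitRingType) (b : bool) (Psi : 'rV[R]_8 -> R) :
  (2%:R : R) \is a GRing.unit ->
  (forall x, Psi x = (-1) ^+ b * \sum_k x 0 k ^+ 2) ->
  alg_isomorphic (clifford Psi) 'M[R]_16.
Proof.
move=> R2 PsiE.
have [F FE] := definite_clifford_lift PsiE (spin_mx_family R b).
have [g gE g_inj] := spinor_matrix_units R2 (clifford_gen_family PsiE).
have [h hE] := alghom_comp g F.
have [I IE] : exists I : alghom (clifford Psi) (clifford Psi), I =1 id.
  by apply: alghomP.
have FK : cancel F g.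
  move=> x; rewrite -[LHS]/((g \o F) x) -hE -[RHS]IE.
  by apply: definite_clifford_ext => k k8; rewrite hE IE /= FE // gE.
(* Scalars embed faithfully in the Clifford algebra, since [F] maps them to scalar matrices, where a
   diagonal entry returns the scalar. *)
apply: (alg_iso_of_cancel FK) => M; apply: g_inj => [c c0|]; last exact: FK.
have /matrixP/(_ 0 0) : c%:M = 0 :> 'M[R]_16.
  by transitivity (algmap c : 'M[R]_16); rewrite // -(alghom_algmap F) c0 rmorph0.
by rewrite !mxE eqxx.
Qed.

(** * Periodicity *)

(** In the last clause, passing a product of eight vectors costs an even number of signs. It is
    stated along a morphism [g] in order to be applied to vectors of U inside the Clifford algebra
    of U + W. *)
Lemma volume_element (R : comNzRingType) (b : bool) (Psi : 'rV[R]_8 -> R) :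
  (forall x, Psi x = (-1) ^+ b * \sum_k x 0 k ^+ 2) ->
  exists w : clifford Psi, [/\ w * w = 1,
    forall y, w * clifford_inj Psi y = - (clifford_inj Psi y * w) &
    forall (A : pzAlgType R) (g : alghom (clifford Psi) A) (x : A),
      (forall y, g (clifford_inj Psi y) * x = - (x * g (clifford_inj Psi y))) ->
      GRing.comm x (g w)].
Proof.
move=> PsiE; exists (sword_eval (clifford_gen Psi) volume); split=> [|y|A g x gx].
- exact: volume_sq (clifford_gen_family PsiE).
- rewrite clifford_inj_gen mulr_sumr mulr_suml -sumrN; apply: eq_bigr => k _.
  apply/algmap_anticomm/(volume_anticomm (clifford_gen_family PsiE)).
  exact: ltn_ord.
rewrite /sword_eval mul1r rmorph_mask_eval; apply: commr_sym.
rewrite /GRing.comm mask_eval_comm ?mul1r // => k _.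
exact: gx.
Qed.

Section UniversalProperty.
Variables (R : comNzRingType) (V : lmodType R) (Phi : V -> R).

(* Abstracting from the construction of the algebra as an iterated quotient, on
   which conversion tests are very expensive. *)
Definition is_clifford (A : pzAlgType R) (c : V -> alg_module A) : Prop :=
  [/\ linear c,
      forall v, (c v : A) * c v = algmap (Phi v),
      forall (B : pzAlgType R) (f : V -> alg_module B), linear f ->
        (forall v, (f v : B) * f v = algmap (Phi v)) ->
        exists F : alghom A B, forall v, F (c v) = f v,
      forall (B : pzAlgType R) (F G : alghom A B),
        (forall v, F (c v) = G (c v)) -> F =1 G &
      forall (B : pzAlgType R) (F : alghom A B) (y : B),
        (forall v, GRing.comm y (F (c v))) -> forall x, GRing.comm y (F x)].

Lemma cliffordP : @is_clifford (clifford Phi) (clifford_inj Phi).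
Proof.
split.
- exact: clifford_inj_linear.
- exact: clifford_sq.
- by move=> B f; apply: clifford_lift.
- by move=> B F G; apply: clifford_ext.
- by move=> B F y; apply: clifford_hom_comm.
Qed.

End UniversalProperty.

Lemma linear_add (R : comNzRingType) (U V : lmodType R) (f g : U -> V) :
  linear f -> linear g -> linear (fun x => f x + g x).
Proof. by move=> lf lg c x y; rewrite lf lg scalerDr addrACA. Qed.

(** * Orthogonal sums in which one summand has a volume element *)

Section Periodicity.
Variables (R : comNzRingType) (V V1 V2 : lmodType R).
Variables (Phi : V -> R) (Phi1 : V1 -> R) (Phi2 : V2 -> R).
Variables (i1 : V1 -> V) (i2 : V2 -> V) (p1 : V -> V1) (p2 : V -> V2).
Hypotheses (i1_lin : linear i1) (i2_lin : linear i2).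
Hypotheses (p1_lin : linear p1) (p2_lin : linear p2).
Hypothesis i1K : cancel i1 p1.
Hypothesis i2K : cancel i2 p2.
Hypothesis p1i2 : forall y, p1 (i2 y) = 0.
Hypothesis p2i1 : forall x, p2 (i1 x) = 0.
Hypothesis i1p1D : forall v, i1 (p1 v) + i2 (p2 v) = v.
Hypothesis Phi1_0 : Phi1 0 = 0.
Hypothesis Phi2_0 : Phi2 0 = 0.
Hypothesis PhiE : forall v, Phi v = Phi1 (p1 v) + Phi2 (p2 v).

Variables A A1 A2 : pzAlgType R.
Variables (c : V -> alg_module A) (c1 : V1 -> alg_module A1).
Variable c2 : V2 -> alg_module A2.
Hypotheses (cP : is_clifford Phi c) (c1P : is_clifford Phi1 c1).
Hypothesis c2P : is_clifford Phi2 c2.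

Variable w : A2.
Hypothesis w_sq : w * w = 1.
Hypothesis w_anticomm : forall y, w * c2 y = - (c2 y * w : A2).
Hypothesis w_comm : forall (B : pzAlgType R) (g : alghom A2 B) (x : B),
  (forall y, g (c2 y) * x = - (x * g (c2 y))) -> GRing.comm x (g w).

Local Notation T := (tensor_product A1 A2).

Let c_anticomm x y : (c (i1 x) : A) * c (i2 y) = - (c (i2 y) * c (i1 x) : A).
Proof.
have [c_lin c_sq _ _ _] := cP; apply: anticomm_of_sqrD.
have cD u v : c u + c v = c (u + v) by rewrite (linear_funD c_lin).
rewrite cD !c_sq -rmorphD !PhiE (linear_funD p1_lin) (linear_funD p2_lin).
by rewrite !i1K !i2K !p1i2 !p2i1 Phi1_0 Phi2_0 !addr0 !add0r.
Qed.

Let to_tensor : exists F : alghom A T,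
  forall v, F (c v) = tensor (c1 (p1 v) : A1) w + tensor 1 (c2 (p2 v) : A2).
Proof.
have [_ _ c_lift _ _] := cP; have [c1_lin c1_sq _ _ _] := c1P.
have [c2_lin c2_sq _ _ _] := c2P.
apply: (c_lift T
  (fun v => tensor (c1 (p1 v) : A1) w + tensor 1 (c2 (p2 v) : A2) : alg_module T)).
  apply: linear_add.
    exact: linear_comp (@tensorl_linear R A1 A2 w) (linear_comp c1_lin p1_lin).
  exact: linear_comp (@tensorr_linear R A1 A2 1) (linear_comp c2_lin p2_lin).
move=> v; rewrite (tensor_sqrD _ w_sq (w_anticomm _)) c1_sq c2_sq.
by rewrite tensor_algmapl tensor_algmapr -rmorphD PhiE.
Qed.

Let from_right : exists g : alghom A2 A, forall y, g (c2 y) = c (i2 y).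
Proof.
have [c_lin c_sq _ _ _] := cP; have [_ _ c2_lift _ _] := c2P.
apply: (c2_lift A (fun y => c (i2 y))) => [|y]; first exact: linear_comp.
by rewrite c_sq PhiE p1i2 i2K Phi1_0 add0r.
Qed.

(* The inverse maps c1 x (x) 1 to c (i1 x) g(w) and 1 (x) y to g(y). *)
Lemma clifford_periodicity : alg_isomorphic A T.
Proof.
have [F FE] := to_tensor; have [g gE] := from_right.
have [c_lin c_sq _ c_ext _] := cP.
have [c1_lin _ c1_lift c1_ext c1_comm] := c1P.
have [c2_lin _ _ c2_ext c2_comm] := c2P.
have c1_0 := linear_fun0 c1_lin; have c2_0 := linear_fun0 c2_lin.
have gw_anticomm v : g w * c (i2 v) = - (c (i2 v) * g w : A).
  by have := congr1 g (w_anticomm v); rewrite rmorphN !rmorphM gE.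
have gw_sq : g w * g w = 1.
  by have := congr1 g w_sq; rewrite rmorphM rmorph1.
have gw_comm x : GRing.comm (c (i1 x) : A) (g w).
  by apply: w_comm => y; rewrite gE c_anticomm opprK.
have [f fE] : exists f : alghom A1 A, forall x, f (c1 x) = (c (i1 x) : A) * g w.
  apply: (c1_lift A (fun x => (c (i1 x) : A) * g w : alg_module A)) => [|x].
    exact: linear_comp (alg_mulr_linear (g w)) (linear_comp c_lin i1_lin).
  rewrite -mulrA (mulrA (g w)) -gw_comm -mulrA gw_sq mulr1.
  by rewrite c_sq PhiE i1K p2i1 Phi2_0 addr0.
(* On vectors, [c (i2 y)] anticommutes with both factors of [f (c1 x)], so the two signs cancel. *)
have fg_comm x y : GRing.comm (f x) (g y).
  apply: c2_comm => {}y; apply/commr_sym; apply: c1_comm => {}x.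
  rewrite /GRing.comm gE fE -[RHS]mulrA gw_anticomm mulrN !mulrA c_anticomm.
  by rewrite mulNr opprK.
have [G GE] := tensor_lift fg_comm.
have [GF GFE] := alghom_comp G F; have [FG FGE] := alghom_comp F G.
have [Fg FgE] := alghom_comp F g; have [Ff FfE] := alghom_comp F f.
have [inl inlE] := tensor_homl A1 A2; have [inr inrE] := tensor_homr A1 A2.
have [I IE] : exists I : alghom A A, I =1 id by apply: alghomP.
have [J JE] : exists J : alghom T T, J =1 id by apply: alghomP.
have Fg_inr y : F (g y) = tensor 1 y.
  rewrite -[LHS]/((F \o g) y) -FgE -inrE.
  apply: c2_ext => v; rewrite FgE inrE /= gE FE p1i2 i2K c1_0.
  by rewrite tensor0l add0r.
(* On vectors, [F] sends c(i1 x) g(w) to (x (x) w) (1 (x) w), and w^2 = 1. *)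
have Ff_inl x : F (f x) = tensor x 1.
  rewrite -[LHS]/((F \o f) x) -FfE -inlE.
  apply: c1_ext => v; rewrite FfE inlE /= fE rmorphM Fg_inr FE i1K p2i1.
  by rewrite c2_0 tensor0r addr0 tensorM w_sq mulr1.
apply: (@alg_iso_of_cancel R _ _ F G) => x.
  rewrite -[LHS]/((G \o F) x) -GFE -[RHS]IE.
  apply: c_ext => v; rewrite GFE IE /= FE rmorphD !GE fE gE rmorph1 mul1r.
  rewrite -mulrA gw_sq mulr1 -[in RHS](i1p1D v).
  by rewrite (linear_funD c_lin).
rewrite -[LHS]/((F \o G) x) -FGE -[RHS]JE.
apply: tensor_ext => a; rewrite FGE JE /= GE rmorph1 ?mulr1 ?mul1r.
  exact: Ff_inl.
exact: Fg_inr.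
Qed.

End Periodicity.

(** The coordinate isomorphisms [k] and [k1] let row spaces of sizes 0 + m and m + 0 be treated
    alike, so one argument serves both signatures. *)
Lemma definite_periodicity (R : comNzRingType) (b : bool) (n : nat)
    (V V1 : lmodType R) (Phi : V -> R) (Phi1 : V1 -> R) (Psi : 'rV[R]_8 -> R)
    (k : V -> 'rV[R]_(n + 8)) (r : 'rV[R]_(n + 8) -> V)
    (k1 : V1 -> 'rV[R]_n) (r1 : 'rV[R]_n -> V1) :
  linear k -> linear r -> cancel k r -> cancel r k ->
  linear k1 -> linear r1 -> cancel k1 r1 -> cancel r1 k1 ->
  (forall v, Phi v = (-1) ^+ b * \sum_i k v 0 i ^+ 2) ->
  (forall v, Phi1 v = (-1) ^+ b * \sum_i k1 v 0 i ^+ 2) ->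
  (forall v, Psi v = (-1) ^+ b * \sum_i v 0 i ^+ 2) ->
  alg_isomorphic (clifford Phi) (tensor_product (clifford Phi1) (clifford Psi)).
Proof.
move=> k_lin r_lin kK rK k1_lin r1_lin k1K r1K PhiE Phi1E PsiE.
have [w [w_sq w_anticomm w_comm]] := volume_element PsiE.
have row_l_lin : linear (fun x : 'rV[R]_n => row_mx x (0 : 'rV[R]_8)).
  by move=> c x y; rewrite scale_row_mx add_row_mx scaler0 addr0.
have row_r_lin : linear (fun y : 'rV[R]_8 => row_mx (0 : 'rV[R]_n) y).
  by move=> c x y; rewrite scale_row_mx add_row_mx scaler0 addr0.
have zero_sum m : (-1) ^+ b * \sum_i (0 : 'rV[R]_m) 0 i ^+ 2 = 0.
  by rewrite big1 ?mulr0 // => i _; rewrite mxE expr0n.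
apply: (@clifford_periodicity R V V1 'rV[R]_8 Phi Phi1 Psi
  (fun x => r (row_mx (k1 x) 0)) (fun y => r (row_mx 0 y))
  (fun v => r1 (lsubmx (k v))) (fun v => rsubmx (k v)))
  (cliffordP Phi) (cliffordP Phi1) (cliffordP Psi) w w_sq w_anticomm w_comm.
- exact: linear_comp r_lin (linear_comp row_l_lin k1_lin).
- exact: linear_comp r_lin row_r_lin.
- by apply: linear_comp r1_lin _ => c x y; rewrite k_lin linearP.
- by move=> c x y; rewrite k_lin linearP.
- by move=> x; rewrite rK row_mxKl k1K.
- by move=> y; rewrite rK row_mxKr.
- by move=> y; rewrite rK row_mxKl (linear_fun0 r1_lin).
- by move=> x; rewrite rK row_mxKr.
- move=> v; rewrite r1K -(linear_funD r_lin) add_row_mx addr0 add0r hsubmxK.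
  exact: kK.
- by rewrite Phi1E (linear_fun0 k1_lin).
- by rewrite PsiE.
move=> v; rewrite PhiE Phi1E PsiE -mulrDr r1K big_split_ord; congr (_ * (_ + _)).
  by apply: eq_bigr => i _; rewrite mxE.
by apply: eq_bigr => i _; rewrite mxE.
Qed.

(** * The forms of signature (p, 0) and (0, q) in coordinates *)

Lemma quadratic_form_pos (R : pzRingType) (p : nat) (x : 'rV[R]_(p + 0)) :
  quadratic_form x = (-1) ^+ false * \sum_i lsubmx x 0 i ^+ 2.
Proof.
rewrite /quadratic_form big_ord0 subr0 mul1r.
by apply: eq_bigr => i _; rewrite mxE.
Qed.

Lemma quadratic_form_neg (R : pzRingType) (q : nat) (x : 'rV[R]_(0 + q)) :
  quadratic_form x = (-1) ^+ true * \sum_i rsubmx x 0 i ^+ 2.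
Proof.
rewrite /quadratic_form big_ord0 sub0r mulN1r; congr (- _).
by apply: eq_bigr => i _; rewrite mxE.
Qed.

Lemma quadratic_form_8_0 (R : pzRingType) (x : 'rV[R]_8) :
  @quadratic_form R 8 0 x = (-1) ^+ false * \sum_i x 0 i ^+ 2.
Proof.
rewrite quadratic_form_pos; congr (_ * _); apply: eq_bigr => i _.
by rewrite mxE; congr (x 0 _ ^+ 2); apply: val_inj.
Qed.

Lemma quadratic_form_0_8 (R : pzRingType) (x : 'rV[R]_8) :
  @quadratic_form R 0 8 x = (-1) ^+ true * \sum_i x 0 i ^+ 2.
Proof.
rewrite quadratic_form_neg; congr (_ * _); apply: eq_bigr => i _.
by rewrite mxE; congr (x 0 _ ^+ 2); apply: val_inj.
Qed.

Lemma row_mx0_lin (R : comNzRingType) p :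
  linear (fun x : 'rV[R]_p => row_mx x (0 : 'rV[R]_0)).
Proof. by move=> c x y; rewrite scale_row_mx add_row_mx scaler0 addr0. Qed.

Lemma row_0mx_lin (R : comNzRingType) q :
  linear (fun x : 'rV[R]_q => row_mx (0 : 'rV[R]_0) x).
Proof. by move=> c x y; rewrite scale_row_mx add_row_mx scaler0 addr0. Qed.

Lemma row_mx0K (R : comNzRingType) p :
  cancel (@lsubmx R 1 p 0) (fun x => row_mx x 0).
Proof. by move=> x; rewrite -[x in RHS]hsubmxK (thinmx0 (rsubmx x)). Qed.

Lemma row_0mxK (R : comNzRingType) q :
  cancel (@rsubmx R 1 0 q) (fun x => row_mx 0 x).
Proof. by move=> x; rewrite -[x in RHS]hsubmxK (thinmx0 (lsubmx x)). Qed.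

Theorem theorem1p17 (R : realType) :
  (forall n : nat,
     alg_isomorphic (Cl R 0 (n + 8)) (tensor_product (Cl R 0 n) (Cl R 0 8)) /\
     alg_isomorphic (Cl R (n + 8) 0) (tensor_product (Cl R n 0) (Cl R 8 0))) /\
  alg_isomorphic (Cl R 0 8) (Cl R 8 0) /\
  alg_isomorphic (Cl R 8 0) 'M[R]_16.
Proof.
have unit2 : (2%:R : R) \is a GRing.unit.
  by rewrite unitfE Num.Theory.pnatr_eq0.
have Cl80 : alg_isomorphic (Cl R 8 0) 'M[R]_16.
  exact: (definite_clifford_matrix unit2 (@quadratic_form_8_0 R)).
have Cl08 : alg_isomorphic (Cl R 0 8) 'M[R]_16.
  exact: (definite_clifford_matrix unit2 (@quadratic_form_0_8 R)).
split; last first.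
  split=> //; exact: alg_isomorphic_trans Cl08 (alg_isomorphic_sym Cl80).
move=> n; split.
  (* The positive block is empty, so the right block gives all the coordinates; [b := true] is the
     negative sign. *)
  apply: (definite_periodicity (b := true) (Psi := @quadratic_form R 0 8)
    (k := @rsubmx R 1 0 (n + 8)) (r := fun x => row_mx 0 x)
    (k1 := @rsubmx R 1 0 n) (r1 := fun x => row_mx 0 x)).
  - exact: linearP.
  - exact: row_0mx_lin.
  - exact: row_0mxK.
  - by move=> x; rewrite row_mxKr.
  - exact: linearP.
  - exact: row_0mx_lin.
  - exact: row_0mxK.
  - by move=> x; rewrite row_mxKr.
  - exact: quadratic_form_neg.
  - exact: quadratic_form_neg.
  - exact: quadratic_form_0_8.
apply: (definite_periodicity (b := false) (Psi := @quadratic_form R 8 0)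
  (k := @lsubmx R 1 (n + 8) 0) (r := fun x => row_mx x 0)
  (k1 := @lsubmx R 1 n 0) (r1 := fun x => row_mx x 0)).
- exact: linearP.
- exact: row_mx0_lin.
- exact: row_mx0K.
- by move=> x; rewrite row_mxKl.
- exact: linearP.
- exact: row_mx0_lin.
- exact: row_mx0K.
- by move=> x; rewrite row_mxKl.
- exact: quadratic_form_pos.
- exact: quadratic_form_pos.
- exact: quadratic_form_8_0.
Qed.
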